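(* The following identities hold: $$\int_0^\infty \tfrac14\ln(1+e^{-u})\,du=\frac{\pi^2}{48},$$ $$\int_0^\infty u\ln(1+e^{-u})\,du=\frac34\zeta(3),$$ $$\int_0^\infty \left(\ln(1+e^{-u})\right)^2du=\frac{\zeta(3)}{4},$$ $$\int_0^\infty \frac{u^3e^{-u}}{1+e^{-u}}\,du=\frac{7\pi^4}{120},$$ $$\int_0^\infty \left(\ln(1+e^{-u})\right)^3du=\frac14\pi^2(\ln 2)^2-\frac{21}{4}\ln(2)\,\zeta(3)-6\,\mathrm{Li}_4(1/2)+\frac1{15}\pi^4-\frac14(\ln 2)^4,$$ $$\int_0^\infty u\left(\ln(1+e^{-u})\right)^2du=4\,\mathrm{Li}_4(1/2)-\frac1{24}\pi^4-\frac16\pi^2(\ln 2)^2+\frac16(\ln 2)^4+\frac72\ln(2)\,\zeta(3),$$ $$\int_0^\infty \frac{u^4e^{-u}}{1+e^{-u}}\,du=\frac{45}{2}\zeta(5),$$ $$\int_0^\infty u\left(\ln(1+e^{-u})\right)^3du=12\,\mathrm{Li}_5(1/2)+12\ln(2)\,\mathrm{Li}_4(1/2)+\frac25(\ln 2)^5+\frac{21}{4}\zeta(3)(\ln 2)^2-\frac{99}{16}\zeta(5)-\frac13\pi^2(\ln 2)^3-\frac12\zeta(3)\pi^2,$$ $$\int_0^\infty \frac{u^3e^{-u}\ln(1+e^{-u})}{1+e^{-u}}\,du=-\frac{87}{16}\zeta(5)+\frac12\pi^2\zeta(3),$$ $$\int_0^\infty \left(\ln(1+e^{-u})\right)^4du=\frac23\pi^2(\ln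 2)^3-\frac{21}{2}(\ln 2)^2\zeta(3)-24\ln(2)\,\mathrm{Li}_4(1/2)-\frac45(\ln 2)^5-24\,\mathrm{Li}_5(1/2)+24\,\zeta(5).$$
   Context: $\zeta$ denotes the Riemann zeta function, and $\mathrm{Li}_m(z):=\sum_{k=1}^{\infty} \frac{z^k}{k^m}$ is the polylogarithm, for $|z|<1$. *)

(* Defs.v *)
From Stdlib Require Export Reals.
From Coquelicot Require Export Coquelicot.
Open Scope R_scope.

(* The Riemann zeta function at a real s > 1, as its Dirichlet series
   sum_(k >= 1) k^(-s); the value at s <= 1 carries no meaning. *)
Definition zeta (s : R) : R := Series (fun n : nat => Rpower (INR (S n)) (- s)).

(* Li_m(z) = sum_(k >= 1) z^k / k^m for real z with |z| < 1; k = n + 1. *)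
Definition Li (m : nat) (z : R) : R :=
  Series (fun n : nat => z ^ S n / INR (S n) ^ m).

(* The improper integral of f over [0, +oo) converges and has value v. *)
Definition is_int_0_infty (f : R -> R) (v : R) : Prop :=
  is_RInt_gen f (at_point 0) (Rbar_locally p_infty) v.

(* Main.v *)
Require Import Defs.
From Stdlib Require Import Reals Lra Lia Factorial.
From Coquelicot Require Import Coquelicot.

(* With b = ln (1 + exp (- u)), the functions of u = - ln x that occur are power
   series in exp (- u), so integrating u ^ p times b, b ^ 2 or their derivatives
   termwise gives zeta values and the sums of s ^ N H_N / N ^ a, s = 1 or -1.
   These Euler sums come from a partial fraction decomposition summed in both orders.
   Pure powers of b become, in the variable b, integrals of v ^ p / (1 - exp (- v))
   over (0, ln 2], which produce the values Li_j (1/2).  The mixed integrals follow from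
   the involution v <-> - ln (1 - exp (- v)): for P symmetric,
     int_0^oo P (v, - ln (1 - exp (- v))) dv = int_0^oo P (b, u + b) du,
   applied to P (x, y) = x y, x y (x + y), x ^ 2 y ^ 2.  The same relations also
   determine Li_2 (1/2) and Li_3 (1/2). *)

(** * Dominated convergence and interchange for series *)

(** Each symmetric polynomial leaves exactly one unknown integral. In the variable [v] only series
    with [s = 1] occur. In the variable [u], with [x = b] and [y = u + b], the three polynomials are
    [u b + b^2], [u^2 b + 3 u b^2 + 2 b^3] and [u^2 b^2 + 2 u b^3 + b^4]; they yield [b^2], [u b^2]
    and [u b^3] in turn, the other terms being evaluated on their own. The detour is forced at
    [u b^2]: termwise integration would lead to the sum of [(-1)^N H_N / N^3], which involves Li_4
    (1/2) and does not come out of the partial fractions. The sum of [s^N H_N / N^4] does come out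
    for both signs, so [u^2 b^2] can be integrated directly. The integrals of [b] and [b^2] are each
    computed in two ways, and the comparison gives Li_2 (1/2) and Li_3 (1/2). The integrals of [b^3]
    and [b^4] have only one evaluation, so Li_4 (1/2) and Li_5 (1/2) stay in the results. A
    substitution is carried out by composing a primitive with the new variable, and only limits of
    primitives at the two ends are compared. *)

Lemma sum_n_S (a : nat -> R) (n : nat) : sum_n a (S n) = sum_n a n + a (S n).
Proof. exact (@sum_Sn R_AbelianMonoid a n). Qed.

Lemma ex_series_ext_R (a b : nat -> R) :
  (forall n, a n = b n) -> ex_series a -> ex_series b.
Proof. exact (ex_series_ext a b). Qed.

Section Filters.

Context {T : Type} (F : (T -> Prop) -> Prop) {FF : ProperFilter F}.

Lemma filterlim_Rplus (f g : T -> R) (a b : R) :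
  filterlim f F (locally a) -> filterlim g F (locally b) ->
  filterlim (fun x => f x + g x) F (locally (a + b)).
Proof.
  intros Hf Hg.
  exact (filterlim_comp_2 f g Rplus Hf Hg (@filterlim_plus R_AbsRing R_NormedModule a b)).
Qed.

Lemma filterlim_Rmult (f g : T -> R) (a b : R) :
  filterlim f F (locally a) -> filterlim g F (locally b) ->
  filterlim (fun x => f x * g x) F (locally (a * b)).
Proof.
  intros Hf Hg.
  exact (filterlim_comp_2 f g Rmult Hf Hg (@filterlim_mult R_AbsRing a b)).
Qed.

Lemma filterlim_Rminus (f g : T -> R) (a b : R) :
  filterlim f F (locally a) -> filterlim g F (locally b) ->
  filterlim (fun x => f x - g x) F (locally (a - b)).
Proof.
  intros Hf Hg.
  replace (a - b) with (a + (-1) * b) by ring.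
  apply filterlim_ext with (fun x => f x + (-1) * g x); [intros; ring|].
  apply filterlim_Rplus; [exact Hf|].
  apply filterlim_Rmult; [apply filterlim_const | exact Hg].
Qed.

Lemma filterlim_unique_R (f : T -> R) (a b : R) :
  filterlim f F (locally a) -> filterlim f F (locally b) -> a = b.
Proof.
  intros Ha Hb.
  exact (filterlim_locally_unique f a b Ha Hb).
Qed.

Lemma Rabs_lim_le (f : T -> R) (l M : R) :
  F (fun x => Rabs (f x) <= M) -> filterlim f F (locally l) -> Rabs l <= M.
Proof.
  intros HM Hl.
  destruct (Rle_or_lt (Rabs l) M) as [H|H]; [exact H|exfalso].
  assert (He : 0 < Rabs l - M) by lra.
  pose proof (proj1 (filterlim_locally f l) Hl (mkposreal _ He)) as Hb.
  destruct (filter_ex _ (filter_and _ _ HM Hb)) as [x [H1 H2]].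
  change (Rabs (f x - l) < Rabs l - M) in H2.
  pose proof (Rabs_triang_inv l (f x)). rewrite Rabs_minus_sym in H2. lra.
Qed.

Lemma filterlim_sum_n (f : T -> nat -> R) (g : nat -> R) (N : nat) :
  (forall n, filterlim (fun x => f x n) F (locally (g n))) ->
  filterlim (fun x => sum_n (f x) N) F (locally (sum_n g N)).
Proof.
  intros H. induction N as [|N IH].
  - rewrite sum_O. apply filterlim_ext with (fun x => f x O); [|apply H].
    intros x. now rewrite sum_O.
  - rewrite sum_Sn.
    apply filterlim_ext with (fun x => sum_n (f x) N + f x (S N)).
    + intros x. now rewrite sum_Sn.
    + now apply filterlim_Rplus.
Qed.

Lemma ex_series_dominated (f M : nat -> R) :
  (forall n, Rabs (f n) <= M n) -> ex_series M -> ex_series f.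
Proof. intros H1 H2. exact (@ex_series_le R_AbsRing R_CompleteNormedModule f M H1 H2). Qed.

Lemma Series_tail (f : nat -> R) (N : nat) :
  ex_series f -> Series f = sum_n f N + Series (fun k => f (S N + k)%nat).
Proof.
  intros H. rewrite (Series_incr_n f (S N)); [|lia|exact H].
  now rewrite sum_n_Reals.
Qed.

Lemma Series_dominated (f M : nat -> R) :
  (forall n, Rabs (f n) <= M n) -> ex_series M -> Rabs (Series f) <= Series M.
Proof.
  intros H1 H2.
  assert (Ha : ex_series (fun n => Rabs (f n))).
  { apply ex_series_dominated with M; [|exact H2].
    intros n. rewrite Rabs_Rabsolu. apply H1. }
  eapply Rle_trans; [apply Series_Rabs, Ha|].
  apply Series_le; [|exact H2].
  intros n. split; [apply Rabs_pos|apply H1].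
Qed.

(** Cut at an index past which the tail of [M] is below [eps / 3]: the finite head converges term by
    term, and the tails of [f x] and [g] are both bounded by that of [M]. Stating it for any proper
    filter serves the limits at [0+], at infinity and along partial sums alike. *)
Lemma tannery (f : T -> nat -> R) (g M : nat -> R) :
  F (fun x => forall n, Rabs (f x n) <= M n) ->
  (forall n, filterlim (fun x => f x n) F (locally (g n))) ->
  ex_series M ->
  filterlim (fun x => Series (f x)) F (locally (Series g)).
Proof.
  intros Hdom Hlim HM.
  assert (Hg : forall n, Rabs (g n) <= M n).
  { intros n. apply (Rabs_lim_le (fun x => f x n)); [|apply Hlim].
    revert Hdom. apply filter_imp. auto. }
  apply filterlim_locally. intros eps.
  assert (He : 0 < eps / 3) by (destruct eps; simpl; lra).
  destruct (proj1 (filterlim_locally _ _) (Series_correct M HM) (mkposreal _ He)) as [N HN].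
  specialize (HN N (Nat.le_refl N)).
  change (Rabs (sum_n M N - Series M) < eps / 3) in HN.
  rewrite (Series_tail M N HM) in HN.
  pose proof (proj1 (filterlim_locally _ _) (filterlim_sum_n f g N Hlim) (mkposreal _ He)) as HS.
  generalize (filter_and _ _ Hdom HS). apply filter_imp.
  intros x [H1 H2].
  change (Rabs (sum_n (f x) N - sum_n g N) < eps / 3) in H2.
  change (Rabs (Series (f x) - Series g) < eps).
  rewrite (Series_tail (f x) N), (Series_tail g N);
    [| now apply ex_series_dominated with M | now apply ex_series_dominated with M].
  assert (HMt : ex_series (fun k => M (S N + k)%nat)) by now apply ex_series_incr_n.
  pose proof (Series_dominated (fun k => f x (S N + k)%nat) _ (fun k => H1 _) HMt) as B1.
  pose proof (Series_dominated (fun k => g (S N + k)%nat) _ (fun k => Hg _) HMt) as B2.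
  set (a := Series (fun k => f x (S N + k)%nat)) in *.
  set (b := Series (fun k => g (S N + k)%nat)) in *.
  set (m := Series (fun k => M (S N + k)%nat)) in *.
  apply Rabs_def2 in HN. apply Rabs_def2 in H2.
  apply Rabs_le_between in B1. apply Rabs_le_between in B2.
  apply Rabs_def1; lra.
Qed.

End Filters.

Lemma Series_nonneg (a : nat -> R) :
  (forall n, 0 <= a n) -> ex_series a -> 0 <= Series a.
Proof.
  intros Ha Hs.
  replace 0 with (Series (fun _ : nat => 0 * 0)) by (rewrite Series_scal_l; ring).
  apply Series_le; [|exact Hs].
  intros n. specialize (Ha n). lra.
Qed.

Lemma sum_n_Series (a : nat -> nat -> R) (N : nat) :
  (forall n, ex_series (a n)) ->
  ex_series (fun k => sum_n (fun n => a n k) N) /\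
  Series (fun k => sum_n (fun n => a n k) N) = sum_n (fun n => Series (a n)) N.
Proof.
  intros H. induction N as [|N [IH1 IH2]].
  - split.
    + apply ex_series_ext_R with (a O); [|apply H]. intros k. now rewrite sum_O.
    + rewrite sum_O. apply Series_ext. intros k. now rewrite sum_O.
  - split.
    + apply ex_series_ext_R with (fun k => sum_n (fun n => a n k) N + a (S N) k).
      * intros k. now rewrite sum_Sn.
      * exact (ex_series_plus _ _ IH1 (H (S N))).
    + rewrite sum_Sn, <- IH2.
      rewrite (Series_ext _ (fun k => sum_n (fun n => a n k) N + a (S N) k)).
      * exact (Series_plus _ _ IH1 (H (S N))).
      * intros k. now rewrite sum_Sn.
Qed.

(** A finite sum over [n] commutes with the series over [k]; [tannery] then lets the number of rows
    go to infinity, the column sums of absolute values being the dominating sequence. Domination by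
    a product of two summable sequences is a form of Fubini's hypothesis that is easy to check on
    the double series below. *)
Lemma Series_swap (a : nat -> nat -> R) (u w : nat -> R) :
  (forall n k, Rabs (a n k) <= u n * w k) -> ex_series u -> ex_series w ->
  Series (fun n => Series (fun k => a n k)) = Series (fun k => Series (fun n => a n k)).
Proof.
  intros H Hu Hw.
  assert (Hrow : forall n, ex_series (a n)).
  { intros n. apply ex_series_dominated with (fun k => u n * w k); [auto|].
    now apply (ex_series_scal_l (u n) w). }
  assert (Hcol : forall k, ex_series (fun n => Rabs (a n k))).
  { intros k. apply ex_series_dominated with (fun n => u n * w k).
    - intros n. rewrite Rabs_Rabsolu. auto.
    - now apply (ex_series_scal_r (w k) u). }
  assert (Hrows : ex_series (fun n => Series (a n))).
  { apply ex_series_dominated with (fun n => u n * Series w).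
    - intros n. rewrite <- Series_scal_l. apply Series_dominated; [auto|].
      now apply (ex_series_scal_l (u n) w).
    - now apply (ex_series_scal_r (Series w) u). }
  apply (filterlim_unique_R eventually (sum_n (fun n => Series (a n)))).
  - exact (Series_correct _ Hrows).
  - apply filterlim_ext with (fun N => Series (fun k => sum_n (fun n => a n k) N)).
    { intros N. now apply sum_n_Series. }
    apply (tannery eventually) with (M := fun k => Series (fun n => Rabs (a n k))).
    + exists O. intros N _ k.
      eapply Rle_trans with (sum_n (fun n => Rabs (a n k)) N).
      * rewrite !sum_n_Reals. apply Rsum_abs.
      * rewrite (Series_tail _ N (Hcol k)).
        assert (0 <= Series (fun j => Rabs (a (S N + j)%nat k))); [|lra].
        apply Series_nonneg; [intros; apply Rabs_pos|].
        now apply (ex_series_incr_n (fun n => Rabs (a n k)) (S N)).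
    + intros k. exact (Series_correct _ (ex_series_Rabs _ (Hcol k))).
    + apply ex_series_dominated with (fun k => Series u * w k).
      * intros k.
        eapply Rle_trans; [apply Series_dominated with (M := fun n => u n * w k)|].
        -- intros n. rewrite Rabs_Rabsolu. auto.
        -- now apply (ex_series_scal_r (w k) u).
        -- rewrite Series_scal_r. lra.
      * now apply (ex_series_scal_l (Series u) w).
Qed.

(** * Improper integrals through primitives *)

(* Integrability on (0, +oo) is recorded through a primitive with limits at both
   ends, so that integrands need not be defined at 0. *)
Definition improper (f : R -> R) (l : R) : Prop :=
  exists (F : R -> R) (a b : R),
    (forall u, 0 < u -> is_derive F u (f u)) /\
    filterlim F (at_right 0) (locally a) /\
    filterlim F (Rbar_locally p_infty) (locally b) /\
    l = b - a.

Lemma at_right_pos (P : R -> Prop) :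
  (forall u, 0 < u -> P u) -> at_right 0 P.
Proof. intros H. exists (mkposreal 1 Rlt_0_1). intros u _ Hu. now apply H. Qed.

Lemma p_infty_pos (P : R -> Prop) :
  (forall u, 0 < u -> P u) -> Rbar_locally p_infty P.
Proof. intros H. exists 0. exact H. Qed.

Lemma improper_ext (f g : R -> R) (l : R) :
  (forall u, 0 < u -> f u = g u) -> improper f l -> improper g l.
Proof.
  intros H (F & a & b & HF & H1). exists F, a, b. split; [|exact H1].
  intros u Hu. rewrite <- H by exact Hu. now apply HF.
Qed.

Lemma improper_plus (f g : R -> R) (l m : R) :
  improper f l -> improper g m -> improper (fun u => f u + g u) (l + m).
Proof.
  intros (F & a & b & HF & Fa & Fb & ->) (G & c & d & HG & Gc & Gd & ->).
  exists (fun u => F u + G u), (a + c), (b + d). refine (conj _ (conj _ (conj _ _))).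
  - intros u Hu. exact (is_derive_plus F G u _ _ (HF u Hu) (HG u Hu)).
  - apply filterlim_Rplus; solve [assumption | typeclasses eauto].
  - apply filterlim_Rplus; solve [assumption | typeclasses eauto].
  - ring.
Qed.

Lemma improper_scal (k : R) (f : R -> R) (l : R) :
  improper f l -> improper (fun u => k * f u) (k * l).
Proof.
  intros (F & a & b & HF & Fa & Fb & ->).
  exists (fun u => k * F u), (k * a), (k * b). refine (conj _ (conj _ (conj _ _))).
  - intros u Hu. exact (is_derive_scal F u k _ (HF u Hu)).
  - apply filterlim_Rmult; [typeclasses eauto | apply filterlim_const | exact Fa].
  - apply filterlim_Rmult; [typeclasses eauto | apply filterlim_const | exact Fb].
  - ring.
Qed.

Lemma constant_on_pos (f : R -> R) (x y : R) :
  (forall u, 0 < u -> is_derive f u 0) -> 0 < x -> 0 < y -> f x = f y.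
Proof.
  intros H Hx Hy.
  destruct (Rtotal_order x y) as [h | [-> | h]]; [| reflexivity | symmetry];
    apply eq_is_derive; try exact h; intros t Ht; apply H; lra.
Qed.

(** The difference is constant on the half-line and tends to 0. This is how exponential series are
    identified with closed forms: differentiate both sides and compare at infinity. *)
Lemma eq_of_derive_limit (f g df : R -> R) (l : R) :
  (forall u, 0 < u -> is_derive f u (df u)) ->
  (forall u, 0 < u -> is_derive g u (df u)) ->
  filterlim f (Rbar_locally p_infty) (locally l) ->
  filterlim g (Rbar_locally p_infty) (locally l) ->
  forall u, 0 < u -> f u = g u.
Proof.
  intros Hf Hg Lf Lg u Hu.
  assert (Hc : forall v, 0 < v -> f v - g v = f u - g u).
  { intros v Hv. apply (constant_on_pos (fun t => f t - g t)); try assumption.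
    intros t Ht. replace 0 with (df t - df t) by ring.
    exact (is_derive_minus f g t _ _ (Hf t Ht) (Hg t Ht)). }
  assert (f u - g u = l - l); [|lra].
  apply (filterlim_unique_R (Rbar_locally p_infty) (fun v => f v - g v)).
  - apply filterlim_ext_loc with (fun _ => f u - g u); [|apply filterlim_const].
    apply p_infty_pos. intros v Hv. symmetry. now apply Hc.
  - apply filterlim_Rminus; solve [assumption | typeclasses eauto].
Qed.

(** Two primitives differ by a constant, which cancels between the two ends. Equating two
    evaluations of one integral is what determines Li_2 (1/2) and Li_3 (1/2). *)
Lemma improper_unique (f : R -> R) (l m : R) :
  improper f l -> improper f m -> l = m.
Proof.
  intros (F & a & b & HF & Fa & Fb & ->) (G & c & d & HG & Gc & Gd & ->).
  assert (Hc : forall v, 0 < v -> F v - G v = F 1 - G 1).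
  { intros v Hv. apply (constant_on_pos (fun t => F t - G t)); try lra.
    intros t Ht. replace 0 with (f t - f t) by ring.
    exact (is_derive_minus F G t _ _ (HF t Ht) (HG t Ht)). }
  assert (F 1 - G 1 = a - c).
  { apply (filterlim_unique_R (at_right 0) (fun v => F v - G v)).
    - apply filterlim_ext_loc with (fun _ => F 1 - G 1); [|apply filterlim_const].
      apply at_right_pos. intros v Hv. symmetry. now apply Hc.
    - apply filterlim_Rminus; solve [assumption | typeclasses eauto]. }
  assert (F 1 - G 1 = b - d); [|lra].
  apply (filterlim_unique_R (Rbar_locally p_infty) (fun v => F v - G v)).
  - apply filterlim_ext_loc with (fun _ => F 1 - G 1); [|apply filterlim_const].
    apply p_infty_pos. intros v Hv. symmetry. now apply Hc.
  - apply filterlim_Rminus; solve [assumption | typeclasses eauto].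
Qed.

Lemma filterlim_at_right_continuous (f : R -> R) (x : R) :
  continuous f x -> filterlim f (at_right x) (locally (f x)).
Proof.
  intros H. eapply filterlim_filter_le_1; [|exact H].
  intros P HP. now apply filter_le_within.
Qed.

(** The given primitive says nothing at 0 itself, so it is compared with the primitive [RInt f 0 x],
    which exists and is continuous at 0 because [f] is continuous everywhere. The limit at [0+]
    fixes the constant between the two. *)
Lemma improper_is_int_0_infty (f : R -> R) (l : R) :
  (forall u, continuous f u) -> improper f l -> is_int_0_infty f l.
Proof.
  intros Hf (F & a & b & HF & Fa & Fb & ->).
  assert (HI : forall x y, ex_RInt f x y).
  { intros x y. apply (ex_RInt_continuous (V := R_CompleteNormedModule)). auto. }
  set (G := fun x : R => RInt f 0 x : R).
  assert (HG : forall x, is_derive G x (f x)).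
  { intros x. apply (is_derive_RInt f G 0 x); [|apply Hf].
    apply filter_forall. intros y. apply (RInt_correct (V := R_CompleteNormedModule)), HI. }
  assert (HG0 : G 0 = 0) by apply (RInt_point (V := R_CompleteNormedModule)).
  assert (Hc : forall x, 0 < x -> G x - F x = G 1 - F 1).
  { intros x Hx. apply (constant_on_pos (fun t => G t - F t)); try lra.
    intros t Ht. replace 0 with (f t - f t) by ring.
    exact (is_derive_minus G F t _ _ (HG t) (HF t Ht)). }
  assert (H0 : G 1 - F 1 = 0 - a).
  { apply (filterlim_unique_R (at_right 0) (fun v => G v - F v)).
    - apply filterlim_ext_loc with (fun _ => G 1 - F 1); [|apply filterlim_const].
      apply at_right_pos. intros v Hv. symmetry. now apply Hc.
    - apply filterlim_Rminus; try typeclasses eauto; [|exact Fa].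
      replace (locally 0) with (locally (G 0)) by now rewrite HG0.
      apply filterlim_at_right_continuous.
      apply (ex_derive_continuous G). now exists (f 0). }
  assert (HL : filterlim G (Rbar_locally p_infty) (locally (b - a))).
  { replace (b - a) with (b + (G 1 - F 1)) by lra.
    apply filterlim_ext_loc with (fun x => F x + (G 1 - F 1)).
    - apply p_infty_pos. intros x Hx. rewrite <- (Hc x Hx). ring.
    - apply filterlim_Rplus; try typeclasses eauto; [exact Fb | apply filterlim_const]. }
  unfold is_int_0_infty, is_RInt_gen. intros P HP.
  specialize (HL P HP). unfold filtermap in HL.
  exists (fun x => x = 0) (fun x => P (G x)); [reflexivity | exact HL |].
  intros x y -> Hy. exists (G y). split; [|exact Hy].
  apply (RInt_correct (V := R_CompleteNormedModule)), HI.
Qed.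

(** * Integrals of exponential series *)

(** The coefficient [c n] goes with the exponent [N = n + 1], so there is no constant term and
    [over_index], division by [N], is termwise integration up to sign. *)
Definition exp_series (c : nat -> R) (v : R) : R :=
  Series (fun n => c n * exp (- (INR (S n) * v))).

Definition over_index (c : nat -> R) (n : nat) : R := c n / INR (S n).

(** Equivalently, the power series in [exp (- v)] has radius of convergence at least 1. *)
Definition tame (c : nat -> R) : Prop :=
  forall v, 0 < v -> ex_series (fun n => Rabs (c n) * exp (- (INR (S n) * v))).

Lemma INR_S_pos (n : nat) : 0 < INR (S n).
Proof. apply lt_0_INR. lia. Qed.

Lemma INR_S_ge_1 (n : nat) : 1 <= INR (S n).
Proof. rewrite S_INR. pose proof (pos_INR n). lra. Qed.

Lemma INR_S_neq_0 (n : nat) : INR (S n) <> 0.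
Proof. pose proof (INR_S_pos n). lra. Qed.

Lemma over_index_le (c : nat -> R) (n : nat) : Rabs (over_index c n) <= Rabs (c n).
Proof.
  unfold over_index, Rdiv. rewrite Rabs_mult.
  rewrite <- (Rmult_1_r (Rabs (c n))) at 2.
  apply Rmult_le_compat_l; [apply Rabs_pos|].
  pose proof (INR_S_ge_1 n) as H.
  rewrite Rabs_pos_eq; [|left; apply Rinv_0_lt_compat; lra].
  rewrite <- Rinv_1. apply Rinv_le_contravar; lra.
Qed.

Lemma tame_over_index (c : nat -> R) : tame c -> tame (over_index c).
Proof.
  intros H v Hv. apply ex_series_dominated with (2 := H v Hv).
  intros n. rewrite Rabs_mult, Rabs_Rabsolu, (Rabs_pos_eq (exp _)) by (left; apply exp_pos).
  apply Rmult_le_compat_r; [left; apply exp_pos | apply over_index_le].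
Qed.

Lemma tame_ex_series (c : nat -> R) (v : R) :
  tame c -> 0 < v -> ex_series (fun n => c n * exp (- (INR (S n) * v))).
Proof.
  intros H Hv. apply ex_series_dominated with (2 := H v Hv).
  intros n. rewrite Rabs_mult, (Rabs_pos_eq (exp _)) by (left; apply exp_pos). lra.
Qed.

Lemma exp_neg_pow (v : R) (n : nat) : exp (- (INR n * v)) = exp (- v) ^ n.
Proof.
  induction n as [|n IH].
  - simpl. rewrite Rmult_0_l, Ropp_0. apply exp_0.
  - rewrite S_INR. simpl pow. rewrite <- IH, <- exp_plus. f_equal. ring.
Qed.

Lemma exp_neg_lt_1 (v : R) : 0 < v -> exp (- v) < 1.
Proof. intros H. rewrite <- exp_0. apply exp_increasing. lra. Qed.

Lemma exp_series_PSeries (c : nat -> R) (v : R) :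
  exp_series c v = PSeries (PS_incr_1 c) (exp (- v)).
Proof.
  rewrite PSeries_incr_1. unfold exp_series, PSeries. rewrite <- Series_scal_l.
  apply Series_ext. intros n. rewrite exp_neg_pow. simpl. ring.
Qed.

Lemma tame_CV_radius (c : nat -> R) (v : R) :
  tame c -> 0 < v -> Rbar_lt (Rabs (exp (- v))) (CV_radius (PS_incr_1 c)).
Proof.
  intros H Hv.
  (* Convergence at [v / 2] places the larger point [exp (- (v / 2))] in the disk, which gives the
     strict inequality at [exp (- v)]. *)
  apply Rbar_lt_le_trans with (exp (- (v / 2))).
  - rewrite Rabs_pos_eq by (left; apply exp_pos). apply exp_increasing. lra.
  - apply (proj1 (Lub_Rbar_correct (CV_disk (PS_incr_1 c)))).
    unfold CV_disk. apply ex_series_incr_1.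
    apply ex_series_ext_R with (2 := H (v / 2) ltac:(lra)).
    intros n. rewrite exp_neg_pow, Rabs_mult, (Rabs_pos_eq (_ ^ _)); [reflexivity|].
    apply pow_le. left. apply exp_pos.
Qed.

Lemma is_derive_exp_series (c : nat -> R) (v : R) :
  tame c -> 0 < v ->
  is_derive (exp_series (over_index c)) v (- exp_series c v).
Proof.
  intros H Hv.
  apply (is_derive_ext (fun t => PSeries (PS_incr_1 (over_index c)) (exp (- t)))).
  { intros t. now rewrite exp_series_PSeries. }
  replace (- exp_series c v)
    with (- exp (- v) * PSeries (PS_derive (PS_incr_1 (over_index c))) (exp (- v))).
  - apply (is_derive_comp (PSeries (PS_incr_1 (over_index c))) (fun t => exp (- t))).
    + apply is_derive_PSeries, tame_CV_radius; [now apply tame_over_index | exact Hv].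
    + auto_derive; [trivial | ring].
  - rewrite exp_series_PSeries, PSeries_incr_1.
    rewrite (PSeries_ext (PS_derive (PS_incr_1 (over_index c))) c); [ring|].
    intros n. unfold PS_derive. cbn [PS_incr_1]. unfold over_index.
    change (INR (S n) * (c n / INR (S n)) = c n). field. apply INR_S_neq_0.
Qed.

(* [upper_gamma p t] is the integral of [s ^ p * exp (- s)] over [t, +oo). *)
Fixpoint upper_gamma (p : nat) (t : R) : R :=
  match p with
  | O => exp (- t)
  | S p' => t ^ p * exp (- t) + INR p * upper_gamma p' t
  end.

Lemma is_derive_upper_gamma (p : nat) (t : R) :
  is_derive (upper_gamma p) t (- (t ^ p * exp (- t))).
Proof.
  induction p as [|p IH].
  - cbn [upper_gamma]. auto_derive; [trivial|]. simpl. ring.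
  - replace (- (t ^ S p * exp (- t)))
      with ((INR (S p) * t ^ p * exp (- t) - t ^ S p * exp (- t))
            + INR (S p) * (- (t ^ p * exp (- t)))) by ring.
    apply (is_derive_plus (fun t => t ^ S p * exp (- t))
                          (fun t => INR (S p) * upper_gamma p t)).
    + auto_derive; [trivial|]. change (Init.Nat.pred (S p)) with p.
      change (match p with O => 1 | S _ => INR p + 1 end) with (INR (S p)). simpl pow. ring.
    + exact (is_derive_scal (upper_gamma p) t (INR (S p)) _ IH).
Qed.

Lemma continuous_upper_gamma (p : nat) (t : R) : continuous (upper_gamma p) t.
Proof.
  apply (ex_derive_continuous (upper_gamma p)). eexists. apply is_derive_upper_gamma.
Qed.

Lemma upper_gamma_0 (p : nat) : upper_gamma p 0 = INR (fact p).
Proof.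
  induction p as [|p IH].
  - simpl. rewrite Ropp_0. apply exp_0.
  - cbn [upper_gamma]. rewrite IH, pow_i by lia.
    rewrite fact_simpl, mult_INR. ring.
Qed.

Lemma upper_gamma_pos (p : nat) (t : R) : 0 <= t -> 0 <= upper_gamma p t.
Proof.
  intros Ht. induction p as [|p IH].
  - left. apply exp_pos.
  - cbn [upper_gamma]. apply Rplus_le_le_0_compat.
    + apply Rmult_le_pos; [now apply pow_le | left; apply exp_pos].
    + apply Rmult_le_pos; [apply pos_INR | exact IH].
Qed.

Lemma upper_gamma_le (p : nat) (t : R) : 0 <= t -> upper_gamma p t <= INR (fact p).
Proof.
  intros Ht. rewrite <- upper_gamma_0.
  destruct (Req_dec t 0) as [->|Hn]; [lra|].
  destruct (MVT_gen (upper_gamma p) 0 t (fun t => - (t ^ p * exp (- t)))) as [c [Hc E]].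
  - intros x _. apply is_derive_upper_gamma.
  - intros x _. apply continuity_pt_filterlim, continuous_upper_gamma.
  - rewrite Rmin_left, Rmax_right in Hc by lra.
    assert (0 <= c ^ p * exp (- c) * (t - 0)); [|lra].
    apply Rmult_le_pos; [|lra].
    apply Rmult_le_pos; [apply pow_le; lra | left; apply exp_pos].
Qed.

(** The left side is one of the nonnegative terms of [upper_gamma p t], which decreases from
    [p!]. *)
Lemma pow_exp_le (p : nat) (t : R) : 0 <= t -> t ^ p * exp (- t) <= INR (fact p).
Proof.
  intros Ht. eapply Rle_trans; [|apply (upper_gamma_le p t Ht)].
  destruct p as [|p]; cbn [upper_gamma]; [simpl; lra|].
  assert (0 <= INR (S p) * upper_gamma p t); [|lra].
  apply Rmult_le_pos; [apply pos_INR | now apply upper_gamma_pos].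
Qed.

Lemma pow_exp_p_infty (p : nat) :
  filterlim (fun t => t ^ p * exp (- t)) (Rbar_locally p_infty) (locally 0).
Proof.
  apply (filterlim_le_le (fun _ => 0) _ (fun t => INR (fact (S p)) * / t) (Finite 0)).
  - exists 0. intros t Ht. split.
    + apply Rmult_le_pos; [apply pow_le; lra | left; apply exp_pos].
    + apply Rmult_le_reg_l with t; [exact Ht|].
      pose proof (pow_exp_le (S p) t ltac:(lra)) as H. simpl pow in H.
      replace (t * (INR (fact (S p)) * / t)) with (INR (fact (S p))) by (field; lra). lra.
  - apply filterlim_const.
  - change (is_lim (fun t => INR (fact (S p)) * / t) p_infty 0).
    evar_last.
    + apply is_lim_scal_l. apply is_lim_inv; [apply is_lim_id | discriminate].
    + simpl. f_equal. ring.
Qed.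

Lemma upper_gamma_p_infty (p : nat) :
  filterlim (upper_gamma p) (Rbar_locally p_infty) (locally 0).
Proof.
  induction p as [|p IH].
  - apply filterlim_ext with (2 := pow_exp_p_infty 0). intros t. simpl. ring.
  - replace 0 with (0 + INR (S p) * 0) by ring.
    apply (filterlim_Rplus _ (fun t => t ^ S p * exp (- t))); [apply pow_exp_p_infty|].
    apply filterlim_Rmult; [typeclasses eauto | apply filterlim_const | exact IH].
Qed.

(** With [N = n + 1], the factor [exp (- N v)] is at most [p! / (N v)^p]. *)
Lemma tame_of_summable (c : nat -> R) (p : nat) :
  ex_series (fun n => Rabs (c n) / INR (S n) ^ p) -> tame c.
Proof.
  intros H v Hv.
  apply ex_series_dominated with (fun n => INR (fact p) / v ^ p * (Rabs (c n) / INR (S n) ^ p)).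
  2: now apply (ex_series_scal_l (INR (fact p) / v ^ p) (fun n => Rabs (c n) / INR (S n) ^ p)).
  intros n. pose proof (INR_S_pos n) as Hn.
  pose proof (pow_exp_le p (INR (S n) * v) ltac:(apply Rmult_le_pos; lra)) as B.
  rewrite Rpow_mult_distr in B.
  pose proof (pow_lt v p Hv) as P1. pose proof (pow_lt _ p Hn) as P2.
  rewrite Rabs_mult, Rabs_Rabsolu, (Rabs_pos_eq (exp _)) by (left; apply exp_pos).
  replace (INR (fact p) / v ^ p * (Rabs (c n) / INR (S n) ^ p))
    with (Rabs (c n) * (INR (fact p) / (INR (S n) ^ p * v ^ p))) by (field; lra).
  apply Rmult_le_compat_l; [apply Rabs_pos|].
  apply Rle_div_r; [now apply Rmult_lt_0_compat | lra].
Qed.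

(* Repeated integration by parts of [v ^ p * exp_series c v], up to sign. *)
Fixpoint exp_series_prim (p : nat) (c : nat -> R) (v : R) : R :=
  match p with
  | O => exp_series (over_index c) v
  | S p' => v ^ p * exp_series (over_index c) v
            + INR p * exp_series_prim p' (over_index c) v
  end.

Lemma is_derive_exp_series_prim (p : nat) (c : nat -> R) (v : R) :
  tame c -> 0 < v ->
  is_derive (exp_series_prim p c) v (- (v ^ p * exp_series c v)).
Proof.
  revert c. induction p as [|p IH]; intros c H Hv.
  - replace (- (v ^ 0 * exp_series c v)) with (- exp_series c v) by (simpl; ring).
    now apply is_derive_exp_series.
  - replace (- (v ^ S p * exp_series c v))
      with ((INR (S p) * v ^ p * exp_series (over_index c) v + v ^ S p * (- exp_series c v))
            + INR (S p) * (- (v ^ p * exp_series (over_index c) v))) by ring.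
    apply (is_derive_plus (fun v => v ^ S p * exp_series (over_index c) v)
                          (fun v => INR (S p) * exp_series_prim p (over_index c) v)).
    + apply (is_derive_mult (fun v => v ^ S p) (exp_series (over_index c)) v).
      * auto_derive; [trivial|]. change (1 * (INR (S p) * v ^ p) = INR (S p) * v ^ p). ring.
      * now apply is_derive_exp_series.
      * intros; apply Rmult_comm.
    + apply (is_derive_scal (exp_series_prim p (over_index c))).
      apply IH; [now apply tame_over_index | exact Hv].
Qed.

(** In this form [v] enters only through [upper_gamma], which is bounded by [p!], equals [p!] at 0
    and vanishes at infinity. Both limits of the primitive then follow by domination, whereas the
    separate terms of the recursive form need not converge at 0. *)
Lemma exp_series_prim_eq (p : nat) (c : nat -> R) (v : R) :
  tame c -> 0 < v ->
  ex_series (fun n => c n / INR (S n) ^ S p * upper_gamma p (INR (S n) * v)) /\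
  exp_series_prim p c v =
  Series (fun n => c n / INR (S n) ^ S p * upper_gamma p (INR (S n) * v)).
Proof.
  revert c. induction p as [|p IH]; intros c H Hv.
  - assert (E : forall n, over_index c n * exp (- (INR (S n) * v)) =
                c n / INR (S n) ^ 1 * upper_gamma 0 (INR (S n) * v)).
    { intros n. unfold over_index. cbn [upper_gamma]. now rewrite pow_1. }
    split.
    + apply (ex_series_ext_R _ _ E). apply tame_ex_series; [now apply tame_over_index | exact Hv].
    + exact (Series_ext _ _ E).
  - destruct (IH (over_index c) (tame_over_index c H) Hv) as [I1 I2].
    set (A := fun n => v ^ S p * (over_index c n * exp (- (INR (S n) * v)))).
    set (B := fun n => INR (S p) *
                (over_index c n / INR (S n) ^ S p * upper_gamma p (INR (S n) * v))).
    assert (E : forall n, A n + B n =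
                c n / INR (S n) ^ S (S p) * upper_gamma (S p) (INR (S n) * v)).
    { intros n. unfold A, B, over_index. cbn [upper_gamma].
      rewrite Rpow_mult_distr. rewrite <- !tech_pow_Rmult.
      pose proof (INR_S_neq_0 n). field. split; [now apply pow_nonzero | assumption]. }
    assert (HA : ex_series A).
    { apply (ex_series_scal_l (v ^ S p)
               (fun n => over_index c n * exp (- (INR (S n) * v)))).
      apply tame_ex_series; [now apply tame_over_index | exact Hv]. }
    assert (HB : ex_series B) by exact (ex_series_scal_l (INR (S p)) _ I1).
    split.
    + apply (ex_series_ext_R _ _ E). exact (ex_series_plus _ _ HA HB).
    + rewrite <- (Series_ext _ _ E), Series_plus by assumption.
      unfold A, B. rewrite !Series_scal_l. rewrite <- I2. reflexivity.
Qed.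

Section Exp_series_limits.

Context (p : nat) (c : nat -> R)
  (Hc : ex_series (fun n => Rabs (c n) / INR (S n) ^ S p)).

Lemma exp_series_prim_lim (F : (R -> Prop) -> Prop) {FF : ProperFilter F} (l : R) :
  F (fun v => 0 < v) ->
  (forall n, filterlim (fun v => upper_gamma p (INR (S n) * v)) F (locally l)) ->
  filterlim (exp_series_prim p c) F (locally (l * Series (fun n => c n / INR (S n) ^ S p))).
Proof.
  intros Hpos Hl.
  assert (Ht : tame c) by exact (tame_of_summable c (S p) Hc).
  apply filterlim_ext_loc with
    (fun v => Series (fun n => c n / INR (S n) ^ S p * upper_gamma p (INR (S n) * v))).
  { revert Hpos. apply filter_imp. intros v Hv. symmetry. now apply exp_series_prim_eq. }
  rewrite <- Series_scal_l.
  apply (tannery F) with (M := fun n => INR (fact p) * (Rabs (c n) / INR (S n) ^ S p)).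
  - revert Hpos. apply filter_imp. intros v Hv n.
    pose proof (INR_S_pos n) as Hn.
    assert (H0 : 0 <= INR (S n) * v) by (apply Rmult_le_pos; lra).
    pose proof (upper_gamma_pos p _ H0). pose proof (upper_gamma_le p _ H0).
    rewrite Rabs_mult, (Rabs_pos_eq (upper_gamma _ _)) by assumption.
    rewrite Rmult_comm. unfold Rdiv. rewrite Rabs_mult, (Rabs_pos_eq (/ _)).
    + apply Rmult_le_compat_r; [|assumption].
      apply Rmult_le_pos; [apply Rabs_pos|].
      left. now apply Rinv_0_lt_compat, pow_lt.
    + left. now apply Rinv_0_lt_compat, pow_lt.
  - intros n. rewrite Rmult_comm.
    apply filterlim_Rmult; [typeclasses eauto | apply filterlim_const | apply Hl].
  - now apply (ex_series_scal_l (INR (fact p)) (fun n => Rabs (c n) / INR (S n) ^ S p)).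
Qed.

Lemma exp_series_prim_at_0 :
  filterlim (exp_series_prim p c) (at_right 0)
    (locally (INR (fact p) * Series (fun n => c n / INR (S n) ^ S p))).
Proof.
  apply exp_series_prim_lim; [typeclasses eauto | now apply at_right_pos |].
  intros n. rewrite <- upper_gamma_0.
  replace (upper_gamma p 0) with (upper_gamma p (INR (S n) * 0)) by (f_equal; ring).
  apply (filterlim_at_right_continuous (fun v => upper_gamma p (INR (S n) * v))).
  apply (continuous_comp (fun v => INR (S n) * v) (upper_gamma p)).
  - apply (continuous_mult (fun _ => INR (S n)) (fun v => v));
      [apply continuous_const | apply continuous_id].
  - apply continuous_upper_gamma.
Qed.

Lemma exp_series_prim_p_infty :
  filterlim (exp_series_prim p c) (Rbar_locally p_infty) (locally 0).
Proof.
  replace 0 with (0 * Series (fun n => c n / INR (S n) ^ S p)) by ring.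
  apply exp_series_prim_lim; [typeclasses eauto | now apply p_infty_pos |].
  intros n. apply (filterlim_comp _ _ _ (fun v => INR (S n) * v) (upper_gamma p)
                     _ (Rbar_locally p_infty)); [|apply upper_gamma_p_infty].
  pose proof (INR_S_ge_1 n) as Hn.
  intros P [M HM]. exists (Rmax M 0). intros v Hv. apply HM.
  apply Rmax_Rlt in Hv. nra.
Qed.

Lemma improper_exp_series :
  improper (fun v => v ^ p * exp_series c v)
    (INR (fact p) * Series (fun n => c n / INR (S n) ^ S p)).
Proof.
  exists (fun v => (-1) * exp_series_prim p c v),
    ((-1) * (INR (fact p) * Series (fun n => c n / INR (S n) ^ S p))), ((-1) * 0).
  refine (conj _ (conj _ (conj _ _))).
  - intros v Hv.
    replace (v ^ p * exp_series c v) with ((-1) * - (v ^ p * exp_series c v)) by ring.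
    apply (is_derive_scal (exp_series_prim p c)), is_derive_exp_series_prim; [|exact Hv].
    exact (tame_of_summable c (S p) Hc).
  - apply filterlim_Rmult;
      [typeclasses eauto | apply filterlim_const | exact exp_series_prim_at_0].
  - apply filterlim_Rmult;
      [typeclasses eauto | apply filterlim_const | exact exp_series_prim_p_infty].
  - ring.
Qed.

End Exp_series_limits.

(** * The values of zeta at 2 and 4 *)

(* Two integrations by parts show that the ratios [cos_moment m n / cos_moment 0 n]
   telescope: their increments in [n] are [1 / (2 n ^ 2)] for [m = 2] and
   [3 / n ^ 2] times the ratio for [m = 2] when [m = 4]. *)
Definition cos_moment (m n : nat) : R :=
  RInt (fun x => x ^ m * cos x ^ (2 * n)) 0 (PI / 2).

Lemma is_RInt_cos_moment (m n : nat) :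
  is_RInt (fun x => x ^ m * cos x ^ (2 * n)) 0 (PI / 2) (cos_moment m n).
Proof.
  apply (RInt_correct (V := R_CompleteNormedModule)).
  apply (ex_RInt_continuous (V := R_CompleteNormedModule)).
  intros x _. apply (ex_derive_continuous (fun x => x ^ m * cos x ^ (2 * n))).
  auto_derive. trivial.
Qed.

Lemma half_PI_pos : 0 < PI / 2.
Proof. pose proof PI_RGT_0. lra. Qed.

(** Green's identity for [g = x^(j+2)] and [f = cos^(2K)]: the derivative of [g f' - g' f] is
    [g f'' - g'' f], and [f'' = 2K (2K - 1) cos^(2K-2) - 4 K^2 cos^(2K)]. The boundary terms vanish,
    at 0 by the powers of [x] and at [PI / 2] by those of the cosine. *)
Lemma cos_moment_recurrence (j n : nat) :
  let K := INR (S n) in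
  2 * K * (2 * K - 1) * cos_moment (S (S j)) n - 4 * K ^ 2 * cos_moment (S (S j)) (S n)
  = INR (S (S j)) * INR (S j) * cos_moment j (S n).
Proof.
  intros K.
  set (Phi := fun x => x ^ S (S j) * (- (2 * K) * sin x * cos x ^ S (2 * n))
                       - INR (S (S j)) * x ^ S j * cos x ^ S (S (2 * n))).
  set (dPhi := fun x => 2 * K * (2 * K - 1) * (x ^ S (S j) * cos x ^ (2 * n))
                        - 4 * K ^ 2 * (x ^ S (S j) * cos x ^ (2 * S n))
                        - INR (S (S j)) * INR (S j) * (x ^ j * cos x ^ (2 * S n))).
  assert (HD : forall x, is_derive Phi x (dPhi x)).
  { intros x. unfold Phi, dPhi. replace (2 * S n)%nat with (S (S (2 * n))) by lia.
    auto_derive; [trivial|].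
    change (match j with O => 1 | S _ => INR j + 1 end) with (INR (S j)).
    unfold K. rewrite !S_INR.
    change (match (n + (n + 0))%nat with O => 1 | S _ => INR (n + (n + 0)) + 1 end)
      with (INR (S (n + (n + 0)))).
    rewrite !S_INR, !plus_INR. simpl (INR 0).
    change (n + (n + 0))%nat with (2 * n)%nat.
    simpl pow.
    set (y := cos x ^ (n + (n + 0))).
    pose proof (sin2_cos2 x) as E. unfold Rsqr in E.
    assert (E' : sin x * sin x = 1 - cos x * cos x) by lra.
    ring_simplify.
    replace (sin x ^ 2) with (1 - cos x ^ 2) by (simpl; lra).
    ring. }
  assert (HI : is_RInt dPhi 0 (PI / 2) (minus (Phi (PI / 2)) (Phi 0))).
  { apply (is_RInt_derive Phi dPhi).
    - intros x _. apply HD.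
    - intros x _. apply (ex_derive_continuous dPhi). unfold dPhi. auto_derive. trivial. }
  assert (HJ : is_RInt dPhi 0 (PI / 2)
    (2 * K * (2 * K - 1) * cos_moment (S (S j)) n - 4 * K ^ 2 * cos_moment (S (S j)) (S n)
     - INR (S (S j)) * INR (S j) * cos_moment j (S n))).
  { apply (is_RInt_minus (V := R_NormedModule)
      (fun x => 2 * K * (2 * K - 1) * (x ^ S (S j) * cos x ^ (2 * n))
                - 4 * K ^ 2 * (x ^ S (S j) * cos x ^ (2 * S n)))
      (fun x => INR (S (S j)) * INR (S j) * (x ^ j * cos x ^ (2 * S n)))).
    - apply (is_RInt_minus (V := R_NormedModule)
        (fun x => 2 * K * (2 * K - 1) * (x ^ S (S j) * cos x ^ (2 * n)))
        (fun x => 4 * K ^ 2 * (x ^ S (S j) * cos x ^ (2 * S n)))).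
      + apply (is_RInt_scal (V := R_NormedModule) _ _ _ (2 * K * (2 * K - 1))), is_RInt_cos_moment.
      + apply (is_RInt_scal (V := R_NormedModule) _ _ _ (4 * K ^ 2)), is_RInt_cos_moment.
    - apply (is_RInt_scal (V := R_NormedModule) _ _ _ (INR (S (S j)) * INR (S j))),
        is_RInt_cos_moment. }
  pose proof (is_RInt_unique _ _ _ _ HI) as U1.
  pose proof (is_RInt_unique _ _ _ _ HJ) as U2.
  assert (E1 : Phi (PI / 2) = 0) by (unfold Phi; rewrite cos_PI2; simpl pow; ring).
  assert (E0 : Phi 0 = 0) by (unfold Phi; simpl pow; ring).
  assert (E : minus (Phi (PI / 2)) (Phi 0) = 0).
  { rewrite E1, E0. unfold minus, plus, opp. simpl. ring. }
  rewrite E in U1. rewrite U1 in U2. lra.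
Qed.

(** The Wallis recurrence, from integrating the derivative of [sin x cos^(2n+1) x]. *)
Lemma cos_moment_0_recurrence (n : nat) :
  let K := INR (S n) in
  (2 * K - 1) * cos_moment 0 n = 2 * K * cos_moment 0 (S n).
Proof.
  intros K.
  set (Phi := fun x => sin x * cos x ^ S (2 * n)).
  set (dPhi := fun x => 2 * K * (x ^ 0 * cos x ^ (2 * S n))
                        - (2 * K - 1) * (x ^ 0 * cos x ^ (2 * n))).
  assert (HD : forall x, is_derive Phi x (dPhi x)).
  { intros x. unfold Phi, dPhi. replace (2 * S n)%nat with (S (S (2 * n))) by lia.
    auto_derive; [trivial|].
    unfold K. rewrite !S_INR.
    change (match (n + (n + 0))%nat with O => 1 | S _ => INR (n + (n + 0)) + 1 end)
      with (INR (S (n + (n + 0)))).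
    rewrite !S_INR, !plus_INR. simpl (INR 0).
    simpl pow.
    set (y := cos x ^ (n + (n + 0))).
    pose proof (sin2_cos2 x) as E. unfold Rsqr in E.
    ring_simplify.
    replace (sin x ^ 2) with (1 - cos x ^ 2) by (simpl; lra).
    ring. }
  assert (HI : is_RInt dPhi 0 (PI / 2) (minus (Phi (PI / 2)) (Phi 0))).
  { apply (is_RInt_derive Phi dPhi).
    - intros x _. apply HD.
    - intros x _. apply (ex_derive_continuous dPhi). unfold dPhi. auto_derive. trivial. }
  assert (HJ : is_RInt dPhi 0 (PI / 2)
    (2 * K * cos_moment 0 (S n) - (2 * K - 1) * cos_moment 0 n)).
  { apply (is_RInt_minus (V := R_NormedModule)
      (fun x => 2 * K * (x ^ 0 * cos x ^ (2 * S n)))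
      (fun x => (2 * K - 1) * (x ^ 0 * cos x ^ (2 * n)))).
    - apply (is_RInt_scal (V := R_NormedModule) _ _ _ (2 * K)), is_RInt_cos_moment.
    - apply (is_RInt_scal (V := R_NormedModule) _ _ _ (2 * K - 1)), is_RInt_cos_moment. }
  pose proof (is_RInt_unique _ _ _ _ HI) as U1.
  pose proof (is_RInt_unique _ _ _ _ HJ) as U2.
  assert (E : minus (Phi (PI / 2)) (Phi 0) = 0).
  { unfold Phi. rewrite cos_PI2, sin_0. unfold minus, plus, opp. simpl. ring. }
  rewrite E in U1. rewrite U1 in U2. lra.
Qed.

Lemma cos_moment_at_0 (m : nat) : cos_moment m 0 = (PI / 2) ^ S m / INR (S m).
Proof.
  unfold cos_moment. apply is_RInt_unique.
  replace ((PI / 2) ^ S m / INR (S m))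
    with (minus ((PI / 2) ^ S m / INR (S m)) (0 ^ S m / INR (S m))).
  - apply (is_RInt_derive (fun x => x ^ S m / INR (S m))).
    + intros x _. auto_derive; [trivial|].
      change (match m with O => 1 | S _ => INR m + 1 end) with (INR (S m)).
      simpl pow. field. apply INR_S_neq_0.
    + intros x _. apply (ex_derive_continuous (fun x => x ^ m * cos x ^ (2 * 0))).
      auto_derive. trivial.
  - unfold minus, plus, opp. simpl plus. rewrite pow_i by lia.
    change ((PI / 2) ^ S m / INR (S m) + - (0 / INR (S m)) = (PI / 2) ^ S m / INR (S m)).
    unfold Rdiv. ring.
Qed.

Lemma cos_moment_0_pos (n : nat) : 0 < cos_moment 0 n.
Proof.
  induction n as [|n IH].
  - rewrite cos_moment_at_0. simpl. pose proof half_PI_pos. lra.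
  - pose proof (cos_moment_0_recurrence n) as H. cbv zeta in H.
    pose proof (INR_S_ge_1 n). nra.
Qed.

Lemma x_cos_le_sin (x : R) : 0 <= x <= PI / 2 -> x * cos x <= sin x.
Proof.
  intros [H0 H1].
  destruct (Req_dec x 0) as [->|Hn]; [rewrite sin_0; lra|].
  destruct (MVT_gen (fun x => sin x - x * cos x) 0 x (fun x => x * sin x)) as [c [Hc E]].
  - intros y _. auto_derive; [trivial | ring].
  - intros y _. apply continuity_pt_filterlim.
    apply (ex_derive_continuous (fun x => sin x - x * cos x)). auto_derive. trivial.
  - rewrite Rmin_left, Rmax_right in Hc by lra.
    rewrite sin_0, cos_0 in E. pose proof PI_RGT_0.
    pose proof (sin_ge_0 c ltac:(lra) ltac:(lra)).
    assert (0 <= c * sin c * (x - 0)); [|lra].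
    apply Rmult_le_pos; [apply Rmult_le_pos|]; lra.
Qed.

(** Squaring [x cos x <= sin x] bounds the integrand by [sin^2 x cos^(2n) x = cos^(2n) x -
    cos^(2n+2) x]. *)
Lemma cos_moment_2_le (n : nat) :
  0 <= cos_moment 2 (S n) <= cos_moment 0 n - cos_moment 0 (S n).
Proof.
  pose proof half_PI_pos as HP.
  assert (Hp : forall x, 0 <= cos x ^ (2 * n)).
  { intros x. rewrite pow_mult. apply pow_le, pow2_ge_0. }
  split.
  - apply (is_RInt_le (fun _ => 0) (fun x => x ^ 2 * cos x ^ (2 * S n)) 0 (PI / 2));
      [lra | | apply is_RInt_cos_moment |].
    + evar_last; [apply (is_RInt_const (V := R_NormedModule)) | apply Rmult_0_r].
    + intros x _. rewrite pow_mult. apply Rmult_le_pos; [|apply pow_le]; apply pow2_ge_0.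
  - apply (is_RInt_le (fun x => x ^ 2 * cos x ^ (2 * S n))
             (fun x => x ^ 0 * cos x ^ (2 * n) - x ^ 0 * cos x ^ (2 * S n)) 0 (PI / 2));
      [lra | apply is_RInt_cos_moment | |].
    + apply (is_RInt_minus (V := R_NormedModule)); apply is_RInt_cos_moment.
    + intros x Hx. replace (2 * S n)%nat with (S (S (2 * n))) by lia. cbn [pow].
      pose proof (x_cos_le_sin x ltac:(lra)) as B.
      pose proof (cos_ge_0 x ltac:(lra) ltac:(lra)) as C.
      pose proof (sin2_cos2 x) as E. unfold Rsqr in E.
      specialize (Hp x).
      assert (x * cos x * (x * cos x) <= 1 - cos x * cos x).
      { replace (1 - cos x * cos x) with (sin x * sin x) by lra.
        apply Rmult_le_compat; try exact B; apply Rmult_le_pos; lra. }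
      apply Rle_trans with (cos x ^ (2 * n) * (x * cos x * (x * cos x))); [right; ring|].
      apply Rle_trans with (cos x ^ (2 * n) * (1 - cos x * cos x)); [|right; ring].
      now apply Rmult_le_compat_l.
Qed.

(** The constant comes from [x <= PI / 2 <= 2]. *)
Lemma cos_moment_4_le (n : nat) : 0 <= cos_moment 4 (S n) <= 4 * cos_moment 2 (S n).
Proof.
  pose proof half_PI_pos as HP. pose proof PI_4.
  assert (Hp : forall x, 0 <= cos x ^ (2 * S n)).
  { intros x. rewrite pow_mult. apply pow_le, pow2_ge_0. }
  split.
  - apply (is_RInt_le (fun _ => 0) (fun x => x ^ 4 * cos x ^ (2 * S n)) 0 (PI / 2));
      [lra | | apply is_RInt_cos_moment |].
    + evar_last; [apply (is_RInt_const (V := R_NormedModule)) | apply Rmult_0_r].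
    + intros x Hx. apply Rmult_le_pos; [apply pow_le; lra | apply Hp].
  - apply (is_RInt_le (fun x => x ^ 4 * cos x ^ (2 * S n))
             (fun x => 4 * (x ^ 2 * cos x ^ (2 * S n))) 0 (PI / 2));
      [lra | apply is_RInt_cos_moment | |].
    + apply (is_RInt_scal (V := R_NormedModule) _ _ _ 4), is_RInt_cos_moment.
    + intros x Hx. rewrite <- Rmult_assoc. apply Rmult_le_compat_r; [apply Hp|].
      assert (x ^ 2 <= 4) by nra. pose proof (pow2_ge_0 x).
      replace (x ^ 4) with (x ^ 2 * x ^ 2) by ring. nra.
Qed.

Definition cos_ratio (m n : nat) : R := cos_moment m n / cos_moment 0 n.

(** By the Wallis recurrence the coefficients [2K (2K - 1)] and [4 K^2] become equal after
    normalising by the moments of order 0, so the left side turns into a plain difference. *)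
Lemma cos_ratio_recurrence (j n : nat) :
  cos_ratio (S (S j)) n - cos_ratio (S (S j)) (S n)
  = INR (S (S j)) * INR (S j) / (4 * INR (S n) ^ 2) * cos_ratio j (S n).
Proof.
  pose proof (cos_moment_recurrence j n) as H1.
  pose proof (cos_moment_0_recurrence n) as H2. cbv zeta in H1, H2.
  pose proof (cos_moment_0_pos n) as P1. pose proof (cos_moment_0_pos (S n)) as P2.
  pose proof (INR_S_ge_1 n) as HK.
  unfold cos_ratio. set (K := INR (S n)) in *.
  set (a := cos_moment (S (S j)) n) in *. set (b := cos_moment (S (S j)) (S n)) in *.
  set (d := INR (S (S j)) * INR (S j)) in *. set (e := cos_moment j (S n)) in *.
  assert (E : cos_moment 0 n = 2 * K * cos_moment 0 (S n) / (2 * K - 1)).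
  { rewrite <- H2. field. lra. }
  rewrite E in *.
  replace (d / (4 * K ^ 2) * (e / cos_moment 0 (S n)))
    with (d * e / (4 * K ^ 2 * cos_moment 0 (S n))) by (field; lra).
  rewrite <- H1. field. lra.
Qed.

Lemma cos_ratio_0 (n : nat) : cos_ratio 0 n = 1.
Proof. unfold cos_ratio. pose proof (cos_moment_0_pos n). field. lra. Qed.

Lemma filterlim_inv_INR : filterlim (fun n => / INR (S n)) eventually (locally 0).
Proof.
  change (is_lim_seq (fun n => / INR (S n)) 0).
  apply is_lim_seq_incr_1 with (u := fun n => / INR n).
  apply (is_lim_seq_inv INR p_infty is_lim_seq_INR). discriminate.
Qed.

(** Wallis gives [cos_moment 0 n - cos_moment 0 (S n) = cos_moment 0 (S n) / (2K - 1)], and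
    [2K - 1 >= K]. *)
Lemma cos_ratio_2_lim :
  filterlim (fun n => cos_ratio 2 (S n)) eventually (locally 0).
Proof.
  apply (filterlim_le_le (fun _ => 0) _ (fun n => / INR (S n)) (Finite 0)).
  - exists O. intros n _. pose proof (cos_moment_2_le n) as [B0 B1].
    pose proof (cos_moment_0_recurrence n) as H. cbv zeta in H.
    pose proof (cos_moment_0_pos n) as P0. pose proof (cos_moment_0_pos (S n)) as P1.
    pose proof (INR_S_ge_1 n) as HK. unfold cos_ratio. split.
    + apply Rmult_le_pos; [exact B0 | left; now apply Rinv_0_lt_compat].
    + apply Rle_div_l; [exact P1|].
      apply Rmult_le_reg_l with (INR (S n)); [lra|].
      rewrite <- Rmult_assoc, Rinv_r, Rmult_1_l by lra. nra.
  - apply filterlim_const.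
  - exact filterlim_inv_INR.
Qed.

Lemma cos_ratio_4_lim :
  filterlim (fun n => cos_ratio 4 (S n)) eventually (locally 0).
Proof.
  apply (filterlim_le_le (fun _ => 0) _ (fun n => 4 * cos_ratio 2 (S n)) (Finite 0)).
  - exists O. intros n _. pose proof (cos_moment_4_le n) as [B0 B1].
    pose proof (cos_moment_0_pos (S n)) as P1. unfold cos_ratio. split.
    + apply Rmult_le_pos; [exact B0 | left; now apply Rinv_0_lt_compat].
    + unfold Rdiv. rewrite <- Rmult_assoc. apply Rmult_le_compat_r; [|exact B1].
      left. now apply Rinv_0_lt_compat.
  - apply filterlim_const.
  - change (filterlim (fun n => 4 * cos_ratio 2 (S n)) eventually (locally 0)).
    replace 0 with (4 * 0) by ring.
    apply filterlim_Rmult; [typeclasses eauto | apply filterlim_const | exact cos_ratio_2_lim].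
Qed.

Definition zeta_nat (k : nat) : R := Series (fun n => / INR (S n) ^ k).

(** The sum telescopes from [cos_ratio 2 0 = PI^2 / 12], the origin of [PI^2 / 6]; the ratio at
    [S N] is the exact remainder. *)
Lemma sum_inv_sq (N : nat) :
  sum_n (fun n => / INR (S n) ^ 2) N = PI ^ 2 / 6 - 2 * cos_ratio 2 (S N) :> R.
Proof.
  assert (H : forall n, / INR (S n) ^ 2 = 2 * (cos_ratio 2 n - cos_ratio 2 (S n))).
  { intros n. rewrite cos_ratio_recurrence, cos_ratio_0. simpl (INR 2). simpl (INR 1).
    field. apply INR_S_neq_0. }
  induction N as [|N IH].
  - rewrite sum_O, H. unfold cos_ratio at 1. rewrite !cos_moment_at_0. simpl.
    pose proof PI_RGT_0. field. lra.
  - rewrite sum_n_S, IH, H. ring.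
Qed.

Lemma is_series_inv_sq : is_series (fun n => / INR (S n) ^ 2) (PI ^ 2 / 6).
Proof.
  change (filterlim (sum_n (fun n => / INR (S n) ^ 2)) eventually (locally (PI ^ 2 / 6))).
  apply filterlim_ext with (fun N => PI ^ 2 / 6 - 2 * cos_ratio 2 (S N)).
  { intros N. now rewrite sum_inv_sq. }
  replace (PI ^ 2 / 6) with (PI ^ 2 / 6 - 2 * 0) at 1 by ring.
  apply filterlim_Rminus; [typeclasses eauto | apply filterlim_const |].
  apply filterlim_Rmult; [typeclasses eauto | apply filterlim_const | exact cos_ratio_2_lim].
Qed.

Lemma zeta_nat_2 : zeta_nat 2 = PI ^ 2 / 6.
Proof. apply is_series_unique, is_series_inv_sq. Qed.

Lemma ex_series_inv_pow (k : nat) :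
  (2 <= k)%nat -> ex_series (fun n => / INR (S n) ^ k).
Proof.
  intros Hk. apply ex_series_dominated with (fun n => / INR (S n) ^ 2).
  - intros n. pose proof (INR_S_ge_1 n) as H.
    assert (0 < INR (S n) ^ 2) by (apply pow_lt; lra).
    assert (INR (S n) ^ 2 <= INR (S n) ^ k) by now apply Rle_pow.
    rewrite Rabs_pos_eq; [|left; apply Rinv_0_lt_compat; lra].
    apply Rinv_le_contravar; lra.
  - eexists. apply is_series_inv_sq.
Qed.

(** Let [A_K] be the partial sums of [1 / K^2]. The telescoping increments for [m = 4] are [3 / K^2]
    times [PI^2 / 12 - A_K / 2], and the sum of [A_K / K^2] up to [N] is half of [A_N^2] plus the
    sum of [1 / K^4]. Solving for the latter gives the formula; [PI^4 / 80] is [cos_ratio 4 0]. *)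
Lemma sum_inv_fourth (N : nat) :
  sum_n (fun n => / INR (S n) ^ 4) N =
  PI ^ 2 / 3 * sum_n (fun n => / INR (S n) ^ 2) N - sum_n (fun n => / INR (S n) ^ 2) N ^ 2
  - 4 / 3 * (PI ^ 4 / 80 - cos_ratio 4 (S N)) :> R.
Proof.
  assert (H : forall n, cos_ratio 4 n - cos_ratio 4 (S n) =
    3 / INR (S n) ^ 2 * (PI ^ 2 / 12 - sum_n (fun n => / INR (S n) ^ 2) n / 2)).
  { intros n. rewrite cos_ratio_recurrence, sum_inv_sq.
    replace (INR 4 * INR 3 / (4 * INR (S n) ^ 2)) with (3 / INR (S n) ^ 2).
    - field. apply INR_S_neq_0.
    - simpl (INR 4). simpl (INR 3). field. apply INR_S_neq_0. }
  induction N as [|N IH].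
  - specialize (H O). rewrite !sum_O in *.
    assert (E : cos_ratio 4 0 = PI ^ 4 / 80).
    { unfold cos_ratio. rewrite !cos_moment_at_0. simpl. pose proof PI_RGT_0. field. lra. }
    rewrite E in H. rewrite H. simpl. field.
  - specialize (H (S N)). rewrite !sum_n_S in *. rewrite IH.
    set (A := sum_n (fun n => / INR (S n) ^ 2) N) in *.
    replace (PI ^ 4 / 80 - cos_ratio 4 (S (S N)))
      with (PI ^ 4 / 80 - cos_ratio 4 (S N) + (cos_ratio 4 (S N) - cos_ratio 4 (S (S N))))
      by ring.
    rewrite H. field. apply INR_S_neq_0.
Qed.

Lemma zeta_nat_4 : zeta_nat 4 = PI ^ 4 / 90.
Proof.
  apply is_series_unique.
  change (filterlim (sum_n (fun n => / INR (S n) ^ 4)) eventually (locally (PI ^ 4 / 90))).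
  eapply filterlim_ext; [intros N; symmetry; apply sum_inv_fourth|].
  replace (PI ^ 4 / 90)
    with (PI ^ 2 / 3 * (PI ^ 2 / 6) - PI ^ 2 / 6 * (PI ^ 2 / 6 * 1)
          - 4 / 3 * (PI ^ 4 / 80 - 0)) by field.
  pose proof is_series_inv_sq as HS.
  repeat first [ apply filterlim_Rminus | apply filterlim_Rmult | apply filterlim_const
               | exact HS | exact cos_ratio_4_lim | typeclasses eauto ].
Qed.

(** * Euler sums *)

Fixpoint harm (s : R) (n : nat) : R :=
  match n with
  | O => 0
  | S m => harm s m + s ^ n / INR n
  end.

Lemma harm_S (s : R) (n : nat) : harm s (S n) = harm s n + s ^ S n / INR (S n).
Proof. reflexivity. Qed.

Lemma sign_pow_sq (s : R) (n : nat) : s * s = 1 -> s ^ n * s ^ n = 1.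
Proof. intros Hs. rewrite <- Rpow_mult_distr, Hs. apply pow1. Qed.

Lemma Rabs_sign_pow (s : R) (n : nat) : s * s = 1 -> Rabs (s ^ n) = 1.
Proof.
  intros Hs. pose proof (sign_pow_sq s n Hs) as H.
  pose proof (Rabs_pos (s ^ n)) as P.
  assert (Rabs (s ^ n) * Rabs (s ^ n) = 1) by (rewrite <- Rabs_mult, H; apply Rabs_R1).
  nra.
Qed.

Lemma harm_bound (s : R) (n : nat) : s * s = 1 -> Rabs (harm s n) <= INR n.
Proof.
  intros Hs. induction n as [|n IH].
  - simpl. rewrite Rabs_R0. lra.
  - rewrite harm_S. eapply Rle_trans; [apply Rabs_triang|].
    rewrite (S_INR n) at 2. apply Rplus_le_compat; [exact IH|].
    pose proof (INR_S_ge_1 n) as H.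
    unfold Rdiv. rewrite Rabs_mult, Rabs_sign_pow by exact Hs.
    rewrite Rmult_1_l, Rabs_pos_eq by (left; apply Rinv_0_lt_compat; lra).
    rewrite <- Rinv_1. apply Rinv_le_contravar; lra.
Qed.

Lemma sign_pow_div_lim (s : R) :
  s * s = 1 -> filterlim (fun n => s ^ S n / INR (S n)) eventually (locally 0).
Proof.
  intros Hs.
  change (is_lim_seq (fun n => s ^ S n / INR (S n)) 0).
  apply is_lim_seq_abs_0.
  apply is_lim_seq_ext with (fun n => / INR (S n)); [|exact filterlim_inv_INR].
  intros n. unfold Rdiv. rewrite Rabs_mult, Rabs_sign_pow by exact Hs.
  rewrite Rmult_1_l, Rabs_pos_eq; [reflexivity|].
  left. apply Rinv_0_lt_compat, INR_S_pos.
Qed.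

(** A window of fixed length vanishes even though [harm 1] diverges; the telescoped partial sums
    below leave only such windows. *)
Lemma harm_increment_lim (s : R) (j : nat) :
  s * s = 1 -> filterlim (fun m => harm s (m + j) - harm s m) eventually (locally 0).
Proof.
  intros Hs. induction j as [|j IH].
  - apply filterlim_ext with (fun _ => 0); [|apply filterlim_const].
    intros m. rewrite Nat.add_0_r. ring.
  - apply filterlim_ext with
      (fun m => (harm s (m + j) - harm s m) + s ^ S (m + j) / INR (S (m + j))).
    { intros m. rewrite Nat.add_succ_r, harm_S. ring. }
    replace 0 with (0 + 0) by ring.
    apply filterlim_Rplus; [typeclasses eauto | exact IH |].
    exact (proj1 (is_lim_seq_incr_n (fun n => s ^ S n / INR (S n)) j 0) (sign_pow_div_lim s Hs)).
Qed.

Lemma sum_n_shift (a : nat -> R) (n : nat) :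
  sum_n a (S n) = a O + sum_n (fun k => a (S k)) n :> R.
Proof.
  induction n as [|n IH].
  - now rewrite sum_n_S, !sum_O.
  - rewrite sum_n_S, IH, sum_n_S. ring.
Qed.

Lemma sum_n_scal_l (c : R) (a : nat -> R) (n : nat) :
  sum_n (fun k => c * a k) n = c * sum_n a n :> R.
Proof.
  induction n as [|n IH]; [now rewrite !sum_O|].
  rewrite !sum_n_S, IH. ring.
Qed.

(* The term [i = K] is [s ^ K / 0 = 0]. *)
Lemma sum_sign_div_sub (s : R) (K m : nat) :
  s * s = 1 ->
  sum_n (fun i => s ^ i / (INR i - INR K)) (K + m) = s ^ K * (harm s m - harm s K) :> R.
Proof.
  intros Hs. induction K as [|K IH].
  - rewrite Nat.add_0_l. induction m as [|m IHm].
    + rewrite sum_O. simpl. unfold Rdiv. rewrite Rminus_0_r, Rinv_0. ring.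
    + rewrite sum_n_S, IHm, harm_S. simpl (INR 0). rewrite !Rminus_0_r. simpl (s ^ 0). ring.
  - change (S K + m)%nat with (S (K + m)). rewrite sum_n_shift.
    rewrite (sum_n_ext _ (fun i => s * (s ^ i / (INR i - INR K)))).
    2:{ intros i. rewrite !S_INR. replace (INR i + 1 - (INR K + 1)) with (INR i - INR K) by ring.
        simpl. unfold Rdiv. ring. }
    rewrite (sum_n_scal_l s (fun i => s ^ i / (INR i - INR K))), IH, harm_S.
    pose proof (sign_pow_sq s (S K) Hs) as E. pose proof (INR_S_neq_0 K) as HK.
    replace (s ^ S K * (harm s m - (harm s K + s ^ S K / INR (S K))))
      with (s ^ S K * (harm s m - harm s K) - s ^ S K * s ^ S K / INR (S K)) by (unfold Rdiv; ring).
    rewrite E. simpl (INR 0). simpl (s ^ 0). rewrite <- tech_pow_Rmult. field. lra.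
Qed.

Lemma sum_sign_div_add (s : R) (k M : nat) :
  s * s = 1 ->
  sum_n (fun i => s ^ i / (INR i + INR (S k))) M
  = s ^ S k * (harm s (M + S k) - harm s (S k)) + / INR (S k) :> R.
Proof.
  intros Hs. induction M as [|M IH].
  - rewrite sum_O. change (0 + S k)%nat with (S k). simpl (INR 0). simpl (s ^ 0).
    field. pose proof (INR_S_pos k). lra.
  - rewrite sum_n_S, IH. change (S M + S k)%nat with (S (M + S k)). rewrite (harm_S s (M + S k)).
    replace (INR (S (M + S k))) with (INR (S M) + INR (S k)) by (rewrite <- plus_INR; reflexivity).
    replace (s ^ S (M + S k)) with (s ^ S M * s ^ S k) by (rewrite <- pow_add; reflexivity).
    pose proof (sign_pow_sq s (S k) Hs) as E.
    replace (s ^ S M) with (s ^ S M * (s ^ S k * s ^ S k)) at 1 by (rewrite E; ring).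
    unfold Rdiv. ring.
Qed.

(** Used to correct the diagonal: there a fraction with denominator [N^2 - K^2] is 0 by convention,
    while the other terms of a partial fraction decomposition survive. *)
Definition indicator (k n : nat) : R := if Nat.eqb n k then 1 else 0.

Lemma is_series_indicator (k : nat) : is_series (indicator k) 1.
Proof.
  change (filterlim (sum_n (indicator k)) eventually (locally 1)).
  apply filterlim_ext_loc with (fun _ => 1); [|apply filterlim_const].
  exists k. intros n Hn.
  assert (H : forall m, sum_n (indicator k) m = (if Nat.leb k m then 1 else 0) :> R).
  { intros m. unfold indicator. induction m as [|m IH].
    - rewrite sum_O. now destruct k.
    - rewrite sum_n_S, IH.
      destruct (Nat.leb_spec k m), (Nat.leb_spec k (S m)), (Nat.eqb_spec (S m) k);
        try lia; ring. }
  rewrite H. destruct (Nat.leb_spec k n); [reflexivity | lia].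
Qed.

Lemma is_series_incr_1_R (a : nat -> R) (l : R) :
  is_series a l -> is_series (fun n => a (S n)) (l - a O).
Proof.
  intros H. apply is_series_incr_1.
  evar_last; [exact H|]. change (l = l - a O + a O). ring.
Qed.

Lemma INR_S_sub_neq_0 (n k : nat) : n <> k -> INR (S n) - INR (S k) <> 0.
Proof. intros H E. apply H. assert (INR (S n) = INR (S k)) by lra. apply INR_eq in H0. lia. Qed.

(* The term [n = k] is [s ^ S n / 0 = 0]. *)
Lemma is_series_sign_div_sq_sub (s : R) (k : nat) :
  s * s = 1 ->
  is_series (fun n => s ^ S n / (INR (S n) ^ 2 - INR (S k) ^ 2))
    ((2 + s ^ S k) / (4 * INR (S k) ^ 2)).
Proof.
  intros Hs.
  pose proof (INR_S_pos k) as HK.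
  (* With [K = k + 1], off the diagonal [g i] is [2K s^i / (i^2 - K^2)]. Two terms are corrected
     afterwards: [g 0 = - 2 / K] is dropped, and [g K = - s^K / (2K)], left over by the convention
     on division by 0, is cancelled by the indicator. *)
  set (g := fun i => s ^ i / (INR i - INR (S k)) - s ^ i / (INR i + INR (S k))).
  assert (Hg : is_series g (- / INR (S k))).
  { change (is_lim_seq (sum_n g) (- / INR (S k))).
    apply is_lim_seq_incr_n with (S k).
    apply is_lim_seq_ext with
      (fun m => s ^ S k * - (harm s (m + (S k + S k)) - harm s m) - / INR (S k)).
    - intros m. unfold g.
      assert (E : forall M,
        sum_n (fun i => s ^ i / (INR i - INR (S k)) - s ^ i / (INR i + INR (S k))) M
        = sum_n (fun i => s ^ i / (INR i - INR (S k))) M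
          - sum_n (fun i => s ^ i / (INR i + INR (S k))) M :> R).
      { intros M. induction M as [|M IH]; [now rewrite !sum_O|].
        rewrite !sum_n_S, IH. ring. }
      rewrite E. rewrite (Nat.add_comm m (S k)) at 1.
      rewrite sum_sign_div_sub, sum_sign_div_add by exact Hs.
      rewrite Nat.add_assoc. ring.
    - change (filterlim (fun m => s ^ S k * - (harm s (m + (S k + S k)) - harm s m) - / INR (S k))
                eventually (locally (- / INR (S k)))).
      replace (- / INR (S k)) with (s ^ S k * (- 1 * 0) - / INR (S k)) by ring.
      apply filterlim_Rminus; [typeclasses eauto | | apply filterlim_const].
      apply filterlim_Rmult; [typeclasses eauto | apply filterlim_const |].
      apply filterlim_ext with (fun m => - 1 * (harm s (m + (S k + S k)) - harm s m));
        [intros; ring|].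
      apply filterlim_Rmult; [typeclasses eauto | apply filterlim_const |].
      now apply harm_increment_lim. }
  apply is_series_incr_1_R in Hg.
  pose proof (is_series_plus _ _ _ _ Hg
    (is_series_scal_l (s ^ S k / (2 * INR (S k))) _ _ (is_series_indicator k))) as H.
  apply (is_series_scal_l (/ (2 * INR (S k)))) in H.
  assert (E : (2 + s ^ S k) / (4 * INR (S k) ^ 2)
    = / (2 * INR (S k)) * ((- / INR (S k) - g O) + s ^ S k / (2 * INR (S k)) * 1)).
  { unfold g. simpl (INR 0). simpl (s ^ 0). field. lra. }
  rewrite E. revert H. apply is_series_ext. intros n.
  change (/ (2 * INR (S k)) * (g (S n) + s ^ S k / (2 * INR (S k)) * indicator k n)
          = s ^ S n / (INR (S n) ^ 2 - INR (S k) ^ 2)).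
  unfold g, indicator. pose proof (INR_S_pos n) as HN.
  destruct (Nat.eqb_spec n k) as [->|Hne].
  - unfold Rdiv. rewrite !Rminus_diag, Rinv_0. field. lra.
  - pose proof (INR_S_sub_neq_0 n k Hne).
    field. repeat split; try lra.
    replace (INR (S n) ^ 2 - INR (S k) ^ 2)
      with ((INR (S n) - INR (S k)) * (INR (S n) + INR (S k))) by ring.
    apply Rmult_integral_contrapositive_currified; lra.
Qed.

(** With [N = n + 1], the term is [(1 / K - 1 / (K + N)) / N], so the partial sums are [H_N] minus a
    window of length [N], divided by [N]. This writes a harmonic number as an inner series, turning
    Euler sums into double series. *)
Lemma is_series_inv_mul_add (n : nat) :
  is_series (fun k => / (INR (S k) * (INR (S k) + INR (S n)))) (harm 1 (S n) / INR (S n)).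
Proof.
  pose proof (INR_S_pos n) as HN.
  change (filterlim (sum_n (fun k => / (INR (S k) * (INR (S k) + INR (S n))))) eventually
            (locally (harm 1 (S n) / INR (S n)))).
  apply filterlim_ext with
    (fun m => (harm 1 (S n) - (harm 1 (S m + S n) - harm 1 (S m))) * / INR (S n)).
  - intros m. induction m as [|m IH].
    + rewrite sum_O. change (1 + S n)%nat with (S (S n)).
      rewrite (harm_S 1 (S n)), !pow1. simpl (harm 1 1). simpl (INR 1).
      rewrite (S_INR (S n)). field. lra.
    + rewrite sum_n_S, <- IH. change (S (S m) + S n)%nat with (S (S m + S n)).
      rewrite (harm_S 1 (S m + S n)), (harm_S 1 (S m)), !pow1.
      replace (INR (S (S m + S n))) with (INR (S (S m)) + INR (S n))
        by (rewrite <- plus_INR; reflexivity).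
      pose proof (INR_S_pos (S m)). field. lra.
  - unfold Rdiv. replace (harm 1 (S n)) with (harm 1 (S n) - 0) at 1 by ring.
    apply filterlim_Rmult; [typeclasses eauto | | apply filterlim_const].
    apply filterlim_Rminus; [typeclasses eauto | apply filterlim_const |].
    exact (proj1 (is_lim_seq_incr_1 (fun m => harm 1 (m + S n) - harm 1 m) 0)
             (harm_increment_lim 1 (S n) ltac:(ring))).
Qed.

(** The crude bound [H_N <= N] costs one power of [N], whence [a >= 3]. *)
Lemma ex_series_harm (s : R) (a : nat) :
  s * s = 1 -> (3 <= a)%nat ->
  ex_series (fun n => s ^ S n * harm 1 (S n) / INR (S n) ^ a).
Proof.
  intros Hs Ha. destruct a as [|b]; [lia|].
  apply ex_series_dominated with (2 := ex_series_inv_pow b ltac:(lia)).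
  intros n. pose proof (INR_S_pos n) as HN. pose proof (pow_lt _ b HN) as HP.
  unfold Rdiv. rewrite !Rabs_mult, Rabs_sign_pow by exact Hs.
  rewrite (Rabs_pos_eq (/ _)) by (left; apply Rinv_0_lt_compat, pow_lt, HN).
  pose proof (harm_bound 1 (S n) ltac:(ring)) as B.
  rewrite <- tech_pow_Rmult, Rinv_mult, Rmult_1_l, <- Rmult_assoc.
  rewrite <- (Rmult_1_l (/ INR (S n) ^ b)) at 2.
  apply Rmult_le_compat_r; [left; now apply Rinv_0_lt_compat|].
  apply Rle_div_l; lra.
Qed.

(** The double series of [1 / (N^2 K (K + N))] gives the sum of [H_N / N^3] when summed over [K]
    first. Summed over [N] first, the decomposition [(1 / N^2 - 1 / (N (N + K))) / K^2] gives
    [zeta(2)^2] minus the same sum. *)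
Lemma Series_harm_cube :
  Series (fun n => harm 1 (S n) / INR (S n) ^ 3) = zeta_nat 2 ^ 2 / 2.
Proof.
  set (X := Series (fun n => harm 1 (S n) / INR (S n) ^ 3)).
  assert (HX : ex_series (fun n => harm 1 (S n) / INR (S n) ^ 3)).
  { apply ex_series_ext_R with (2 := ex_series_harm 1 3 ltac:(ring) ltac:(lia)).
    intros n. rewrite pow1. unfold Rdiv. ring. }
  assert (H2 := ex_series_inv_pow 2 (Nat.le_refl 2)).
  assert (E : X = zeta_nat 2 * zeta_nat 2 - X); [|simpl pow; lra].
  transitivity (Series (fun n => Series (fun k =>
    / INR (S n) ^ 2 * / (INR (S k) * (INR (S k) + INR (S n)))))).
  - apply Series_ext. intros n. rewrite Series_scal_l.
    rewrite (is_series_unique _ _ (is_series_inv_mul_add n)).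
    field. apply INR_S_neq_0.
  - rewrite Series_swap with (u := fun n => / INR (S n) ^ 2) (w := fun n => / INR (S n) ^ 2);
      [| | exact H2 | exact H2].
    + rewrite (Series_ext _ (fun k => zeta_nat 2 * / INR (S k) ^ 2 - harm 1 (S k) / INR (S k) ^ 3)).
      * rewrite Series_minus, Series_scal_l; [reflexivity | | exact HX].
        now apply (ex_series_scal_l (zeta_nat 2) (fun n => / INR (S n) ^ 2)).
      * intros k. pose proof (is_series_inv_mul_add k) as HK.
        transitivity (Series (fun n => / INR (S k) ^ 2 * (/ INR (S n) ^ 2
                        - / (INR (S n) * (INR (S n) + INR (S k)))))).
        -- apply Series_ext. intros n. pose proof (INR_S_pos n). pose proof (INR_S_pos k).
           field. lra.
        -- rewrite Series_scal_l, Series_minus, (is_series_unique _ _ HK);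
             [| exact H2 | eexists; exact HK].
           unfold zeta_nat. field. apply INR_S_neq_0.
    + intros n k. pose proof (INR_S_pos n) as HN. pose proof (INR_S_pos k) as HK.
      rewrite Rabs_pos_eq.
      * apply Rmult_le_compat_l; [left; apply Rinv_0_lt_compat, pow_lt, HN|].
        apply Rinv_le_contravar; [apply pow_lt, HK | nra].
      * apply Rmult_le_pos; left; apply Rinv_0_lt_compat; [apply pow_lt, HN | nra].
Qed.

(** For [s = -1] this is minus the Dirichlet eta function. *)
Definition sign_zeta (s : R) (k : nat) : R :=
  Series (fun n => s ^ S n / INR (S n) ^ k).

Lemma ex_series_sign_zeta (s : R) (k : nat) :
  s * s = 1 -> (2 <= k)%nat -> ex_series (fun n => s ^ S n / INR (S n) ^ k).
Proof.
  intros Hs Hk. apply ex_series_dominated with (2 := ex_series_inv_pow k Hk).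
  intros n. unfold Rdiv. rewrite Rabs_mult, Rabs_sign_pow, Rmult_1_l by exact Hs.
  rewrite Rabs_pos_eq; [lra|]. left. apply Rinv_0_lt_compat, pow_lt, INR_S_pos.
Qed.

Lemma Rabs_sq_sub_ge (n k : nat) :
  n <> k -> INR (S k) <= Rabs (INR (S n) ^ 2 - INR (S k) ^ 2).
Proof.
  intros Hne. pose proof (INR_S_pos n). pose proof (INR_S_pos k).
  replace (INR (S n) ^ 2 - INR (S k) ^ 2)
    with ((INR (S n) - INR (S k)) * (INR (S n) + INR (S k))) by ring.
  rewrite Rabs_mult, (Rabs_pos_eq (_ + _)) by lra.
  assert (1 <= Rabs (INR (S n) - INR (S k))); [|nra].
  assert (Hc : (S n + 1 <= S k)%nat \/ (S k + 1 <= S n)%nat) by lia.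
  destruct Hc as [Hc|Hc]; apply le_INR in Hc; rewrite plus_INR in Hc; simpl (INR 1) in Hc.
  - rewrite Rabs_left; lra.
  - rewrite Rabs_pos_eq; lra.
Qed.

(* Summing [2 s^N / (N^2 K (N^2 - K^2))] over [N <> K] in both orders; the terms
   [N = K] are [2 s^N / 0 = 0]. *)
Lemma Series_harm_fourth (s : R) :
  s * s = 1 ->
  Series (fun n => s ^ S n * harm 1 (S n) / INR (S n) ^ 4)
  = zeta_nat 5 / 2 + 5 / 2 * sign_zeta s 5 - zeta_nat 3 * sign_zeta s 2.
Proof.
  intros Hs.
  set (X := Series (fun n => s ^ S n * harm 1 (S n) / INR (S n) ^ 4)).
  assert (HX := ex_series_harm s 4 Hs ltac:(lia)).
  assert (H2 := ex_series_inv_pow 2 (Nat.le_refl 2)).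
  set (a := fun n k => 2 * s ^ S n / (INR (S n) ^ 2 * INR (S k) * (INR (S n) ^ 2 - INR (S k) ^ 2))).
  assert (Hswap : Series (fun n => Series (a n)) = Series (fun k => Series (fun n => a n k))).
  (* The bound [|N^2 - K^2| >= K] off the diagonal supplies the second power of [K]. *)
  { apply Series_swap with (u := fun n => 2 * / INR (S n) ^ 2) (w := fun k => / INR (S k) ^ 2);
      [| now apply (ex_series_scal_l 2 (fun n => / INR (S n) ^ 2)) | exact H2].
    intros n k. unfold a. pose proof (INR_S_pos n) as HN. pose proof (INR_S_pos k) as HK.
    assert (PN := pow_lt _ 2 HN). assert (PK := pow_lt _ 2 HK).
    assert (PI1 : 0 < / INR (S n) ^ 2) by now apply Rinv_0_lt_compat.
    assert (PI2 : 0 < / INR (S k) ^ 2) by now apply Rinv_0_lt_compat.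
    destruct (Nat.eq_dec n k) as [->|Hne].
    - unfold Rdiv. rewrite Rminus_diag, Rmult_0_r, Rinv_0, Rmult_0_r, Rabs_R0. nra.
    - pose proof (Rabs_sq_sub_ge n k Hne) as B.
      unfold Rdiv. rewrite !Rabs_mult, Rabs_sign_pow by exact Hs.
      rewrite Rabs_inv, !Rabs_mult, (Rabs_pos_eq 2), (Rabs_pos_eq (_ ^ 2)),
        (Rabs_pos_eq (INR (S k))) by lra.
      rewrite Rmult_assoc, !Rinv_mult.
      replace (2 * (1 * (/ INR (S n) ^ 2 * / INR (S k) * / Rabs (INR (S n) ^ 2 - INR (S k) ^ 2))))
        with (2 * / INR (S n) ^ 2 * (/ INR (S k) * / Rabs (INR (S n) ^ 2 - INR (S k) ^ 2))) by ring.
      apply Rmult_le_compat_l; [lra|].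
      rewrite <- Rinv_mult. apply Rinv_le_contravar; [exact PK|]. 
      apply Rle_trans with (INR (S k) * INR (S k)); [right; ring|].
      apply Rmult_le_compat_l; [lra | exact B]. }
  (* The term splits as [s^N / N^4] times [2N / (K (K + N)) - 2N / (K^2 - N^2)]. Here [5/2] is
     [3/2], from the second fraction summed over [K], plus 1, from the diagonal correction. *)
  assert (Hrow : forall n, Series (a n)
            = 2 * (s ^ S n * harm 1 (S n) / INR (S n) ^ 4) - 5 / 2 * (s ^ S n / INR (S n) ^ 5)).
  { intros n. pose proof (INR_S_pos n) as HN.
    pose proof (is_series_inv_mul_add n) as A1.
    pose proof (is_series_sign_div_sq_sub 1 n ltac:(ring)) as A2.
    pose proof (is_series_indicator n) as A3.
    transitivity (Series (fun k => s ^ S n / INR (S n) ^ 4 *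
      ((2 * INR (S n) * / (INR (S k) * (INR (S k) + INR (S n)))
       - 2 * INR (S n) * (1 ^ S k / (INR (S k) ^ 2 - INR (S n) ^ 2)))
       - / INR (S n) * indicator n k))).
    - apply Series_ext. intros k. unfold a, indicator. pose proof (INR_S_pos k) as HK.
      rewrite pow1.
      destruct (Nat.eqb_spec k n) as [->|Hne].
      + unfold Rdiv. rewrite !Rminus_diag, Rmult_0_r, Rinv_0. field. lra.
      + pose proof (INR_S_sub_neq_0 k n Hne).
        assert (INR (S n) ^ 2 - INR (S k) ^ 2 <> 0).
        { replace (INR (S n) ^ 2 - INR (S k) ^ 2)
            with (- ((INR (S k) - INR (S n)) * (INR (S k) + INR (S n)))) by ring.
          apply Ropp_neq_0_compat, Rmult_integral_contrapositive_currified; lra. }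
        assert (INR (S k) ^ 2 - INR (S n) ^ 2 <> 0) by lra.
        replace (INR (S k) ^ 2 - INR (S n) ^ 2) with (- (INR (S n) ^ 2 - INR (S k) ^ 2)) by ring.
        field. repeat split; lra.
    - assert (A1' := ex_series_scal_l (2 * INR (S n)) _ (ex_intro _ _ A1)).
      assert (A2' := ex_series_scal_l (2 * INR (S n)) _ (ex_intro _ _ A2)).
      assert (A3' := ex_series_scal_l (/ INR (S n)) _ (ex_intro _ _ A3)).
      rewrite Series_scal_l, Series_minus, Series_minus, !Series_scal_l;
        [| exact A1' | exact A2' | exact (ex_series_minus _ _ A1' A2') | exact A3' ].
      rewrite (is_series_unique _ _ A1), (is_series_unique _ _ A2), (is_series_unique _ _ A3), pow1.
      field. lra. }
  (* Now the term is [2 / K^3] times [s^N / (N^2 - K^2) - s^N / N^2]. The coefficient [5/2] of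
     [s^K / K^5] is [1/2] from the first fraction plus 2 from the diagonal. *)
  assert (Hcol : forall k, Series (fun n => a n k)
            = (/ INR (S k) ^ 5 + 5 / 2 * (s ^ S k / INR (S k) ^ 5))
              - 2 * sign_zeta s 2 * / INR (S k) ^ 3).
  { intros k. pose proof (INR_S_pos k) as HK.
    pose proof (is_series_sign_div_sq_sub s k Hs) as A1.
    pose proof (ex_series_sign_zeta s 2 Hs (Nat.le_refl 2)) as A2.
    pose proof (is_series_indicator k) as A3.
    transitivity (Series (fun n => 2 / INR (S k) ^ 3 *
      ((s ^ S n / (INR (S n) ^ 2 - INR (S k) ^ 2) - s ^ S n / INR (S n) ^ 2)
       + s ^ S k / INR (S k) ^ 2 * indicator k n))).
    - apply Series_ext. intros n. unfold a, indicator. pose proof (INR_S_pos n) as HN.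
      destruct (Nat.eqb_spec n k) as [->|Hne].
      + unfold Rdiv. rewrite !Rminus_diag, Rmult_0_r, Rinv_0. field. lra.
      + pose proof (INR_S_sub_neq_0 n k Hne).
        assert (INR (S n) ^ 2 - INR (S k) ^ 2 <> 0).
        { replace (INR (S n) ^ 2 - INR (S k) ^ 2)
            with ((INR (S n) - INR (S k)) * (INR (S n) + INR (S k))) by ring.
          apply Rmult_integral_contrapositive_currified; lra. }
        field. repeat split; lra.
    - assert (A1' := ex_intro _ _ A1 : ex_series _).
      assert (A3' := ex_series_scal_l (s ^ S k / INR (S k) ^ 2) _ (ex_intro _ _ A3)).
      rewrite Series_scal_l, Series_plus, Series_minus, Series_scal_l;
        [| exact A1' | exact A2 | exact (ex_series_minus _ _ A1' A2) | exact A3' ].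
      rewrite (is_series_unique _ _ A1), (is_series_unique _ _ A3).
      unfold sign_zeta. field. lra. }
  rewrite (Series_ext _ _ Hrow), (Series_ext _ _ Hcol) in Hswap.
  pose proof (ex_series_sign_zeta s 5 Hs ltac:(lia)) as H5s.
  pose proof (ex_series_inv_pow 5 ltac:(lia)) as H5.
  pose proof (ex_series_inv_pow 3 ltac:(lia)) as H3.
  pose proof (ex_series_scal_l (5 / 2) _ H5s) as H5s'.
  pose proof (ex_series_scal_l 2 _ HX) as HX'.
  pose proof (ex_series_scal_l (2 * sign_zeta s 2) _ H3) as H3'.
  rewrite Series_minus, !Series_scal_l in Hswap; [| exact HX' | exact H5s'].
  rewrite Series_minus, Series_plus, !Series_scal_l in Hswap;
    [| exact H5 | exact H5s' | exact (ex_series_plus _ _ H5 H5s') | exact H3'].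
  fold X (sign_zeta s 5) (zeta_nat 5) (zeta_nat 3) in Hswap. lra.
Qed.

Lemma sign_zeta_1 (k : nat) : sign_zeta 1 k = zeta_nat k.
Proof. apply Series_ext. intros n. rewrite pow1. unfold Rdiv. ring. Qed.

(** Adding the two series cancels odd [N] and doubles even [N], leaving [2 / 2^k] times zeta. The
    parity split is taken from power series evaluated at 1. *)
Lemma sign_zeta_opp_1 (k : nat) :
  (2 <= k)%nat -> sign_zeta (-1) k = (2 / 2 ^ k - 1) * zeta_nat k.
Proof.
  intros Hk.
  assert (H := ex_series_inv_pow k Hk).
  assert (Hs := ex_series_sign_zeta (-1) k ltac:(ring) Hk).
  assert (E : sign_zeta (-1) k + zeta_nat k = 2 / 2 ^ k * zeta_nat k); [|lra].
  unfold sign_zeta, zeta_nat at 1. rewrite <- Series_plus by assumption.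
  set (a := fun n => (-1) ^ S n / INR (S n) ^ k + / INR (S n) ^ k).
  assert (P2 := pow_lt 2 k Rlt_0_2).
  assert (Ev : forall n, a (2 * n)%nat = 0).
  { intros n. unfold a. replace ((-1) ^ S (2 * n)) with (-1).
    - unfold Rdiv. ring.
    - rewrite <- tech_pow_Rmult, pow_1_even. ring. }
  assert (Od : forall n, a (2 * n + 1)%nat = 2 / 2 ^ k * / INR (S n) ^ k).
  { intros n. unfold a. replace (S (2 * n + 1)) with (2 * S n)%nat by lia.
    rewrite pow_1_even, mult_INR, Rpow_mult_distr. simpl (INR 2).
    replace (1 + 1) with 2 by ring.
    field. split; [apply pow_nonzero, INR_S_neq_0 | lra]. }
  assert (E1 : forall b, PSeries b 1 = Series b).
  { intros b. apply Series_ext. intros n. rewrite pow1. ring. }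
  assert (E2 : forall b : nat -> R, ex_series b -> ex_pseries b 1).
  { intros b Hb. apply ex_pseries_R. apply ex_series_ext_R with (2 := Hb).
    intros n. rewrite pow1. symmetry. apply Rmult_1_r. }
  rewrite <- (E1 a), PSeries_odd_even; replace (1 ^ 2) with 1 by ring.
  - rewrite !E1, (Series_ext _ _ Od), Series_scal_l.
    rewrite (Series_ext _ (fun n => 0 * 0)), Series_scal_l; [unfold zeta_nat; ring|].
    intros n. rewrite Ev. ring.
  - apply E2. apply ex_series_ext_R with (fun n => 0 * / INR (S n) ^ k).
    + intros n. rewrite Ev. apply Rmult_0_l.
    + now apply (ex_series_scal_l 0 (fun n => / INR (S n) ^ k)).
  - apply E2. apply ex_series_ext_R with (fun n => 2 / 2 ^ k * / INR (S n) ^ k).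
    + intros n. now rewrite Od.
    + now apply (ex_series_scal_l (2 / 2 ^ k) (fun n => / INR (S n) ^ k)).
Qed.

(** * Logarithmic series and the involution *)

(** The factor [- s] makes both cases positive: [ln (1 + exp (- u))] for [s = -1] and
    [- ln (1 - exp (- u))] for [s = 1]. Since [s^2 = 1], the derivative is
    [- exp (- u) / (1 - s exp (- u))] in both. *)
Definition sign_log (s u : R) : R := - s * ln (1 - s * exp (- u)).

Lemma sign_exp_lt_1 (s u : R) : s * s = 1 -> 0 < u -> 0 < 1 - s * exp (- u).
Proof.
  intros Hs Hu. pose proof (exp_neg_lt_1 u Hu). pose proof (exp_pos (- u)).
  assert (s <= 1) by nra. nra.
Qed.

Lemma exp_series_ext (c d : nat -> R) (v : R) :
  (forall n, c n = d n) -> exp_series c v = exp_series d v.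
Proof. intros H. apply Series_ext. intros n. now rewrite H. Qed.

Lemma exp_series_p_infty (c : nat -> R) :
  tame c -> filterlim (exp_series c) (Rbar_locally p_infty) (locally 0).
Proof.
  intros H.
  replace 0 with (Series (fun n => c n * 0)).
  2:{ rewrite Series_scal_r. ring. }
  apply (tannery (Rbar_locally p_infty)) with (M := fun n => Rabs (c n) * exp (- (INR (S n) * 1))).
  - exists 1. intros v Hv n. pose proof (INR_S_pos n).
    rewrite Rabs_mult, (Rabs_pos_eq (exp _)) by (left; apply exp_pos).
    apply Rmult_le_compat_l; [apply Rabs_pos|].
    left. apply exp_increasing. nra.
  - intros n. apply filterlim_Rmult; [typeclasses eauto | apply filterlim_const |].
    apply (filterlim_comp _ _ _ (fun v => INR (S n) * v) (fun t => exp (- t))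
                     _ (Rbar_locally p_infty)).
    + pose proof (INR_S_ge_1 n) as Hn.
      intros P [M HM]. exists (Rmax M 0). intros v Hv. apply HM.
      apply Rmax_Rlt in Hv. nra.
    + exact (upper_gamma_p_infty 0).
  - apply H. lra.
Qed.

Lemma summable_of_le (c : nat -> R) (C : R) (k d : nat) :
  (2 <= k)%nat -> (forall n, Rabs (c n) * INR (S n) ^ k <= C * INR (S n) ^ d) ->
  ex_series (fun n => Rabs (c n) / INR (S n) ^ d).
Proof.
  intros Hk H. apply ex_series_dominated with (fun n => C * / INR (S n) ^ k).
  - intros n. pose proof (INR_S_pos n) as Hn.
    pose proof (pow_lt _ k Hn) as Pk. pose proof (pow_lt _ d Hn) as Pd.
    unfold Rdiv. rewrite Rabs_pos_eq.
    + apply Rle_div_l; [exact Pd|].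
      replace (C * / INR (S n) ^ k * INR (S n) ^ d)
        with (C * INR (S n) ^ d / INR (S n) ^ k) by (unfold Rdiv; ring).
      apply Rle_div_r; [exact Pk | apply H].
    + apply Rmult_le_pos; [apply Rabs_pos | left; now apply Rinv_0_lt_compat].
  - now apply (ex_series_scal_l C (fun n => / INR (S n) ^ k)), ex_series_inv_pow.
Qed.

Section Signed_series.

Context (s : R) (Hs : s * s = 1).

Lemma summable_sign (p : nat) :
  (1 <= p)%nat -> ex_series (fun n => Rabs (s ^ n) / INR (S n) ^ S p).
Proof.
  intros Hp. apply summable_of_le with (C := 1) (k := S p); [lia|].
  intros n. rewrite Rabs_sign_pow by exact Hs. lra.
Qed.

Lemma summable_sign_over_index (p : nat) :
  ex_series (fun n => Rabs (over_index (fun n => s ^ n) n) / INR (S n) ^ S p).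
Proof.
  apply summable_of_le with (C := 1) (k := S (S p)); [lia|].
  intros n. pose proof (INR_S_pos n) as Hn. unfold over_index, Rdiv.
  rewrite Rabs_mult, Rabs_sign_pow by exact Hs.
  rewrite Rabs_pos_eq by (left; now apply Rinv_0_lt_compat).
  rewrite <- (tech_pow_Rmult _ (S p)). right. field. lra.
Qed.

Lemma Rabs_sign_harm (n : nat) : Rabs (s ^ n * harm 1 n) <= INR (S n).
Proof.
  rewrite Rabs_mult, Rabs_sign_pow, Rmult_1_l by exact Hs.
  pose proof (harm_bound 1 n ltac:(ring)). rewrite S_INR. lra.
Qed.

Lemma summable_sign_harm (p : nat) :
  (2 <= p)%nat -> ex_series (fun n => Rabs (s ^ n * harm 1 n) / INR (S n) ^ S p).
Proof.
  intros Hp. apply summable_of_le with (C := 1) (k := p); [lia|].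
  intros n. rewrite Rmult_1_l. rewrite <- tech_pow_Rmult.
  apply Rmult_le_compat_r; [left; apply pow_lt, INR_S_pos | apply Rabs_sign_harm].
Qed.

Lemma summable_sign_harm_over_index (p : nat) :
  (1 <= p)%nat ->
  ex_series (fun n => Rabs (over_index (fun n => 2 * s * (s ^ n * harm 1 n)) n) / INR (S n) ^ S p).
Proof.
  intros Hp. apply summable_of_le with (C := 2) (k := S p); [lia|].
  intros n. pose proof (INR_S_pos n) as Hn. pose proof (pow_lt _ (S p) Hn).
  apply Rmult_le_compat_r; [lra|].
  unfold over_index, Rdiv. rewrite Rabs_mult.
  rewrite (Rabs_pos_eq (/ _)) by (left; now apply Rinv_0_lt_compat).
  apply Rle_div_l; [exact Hn|].
  rewrite !(Rabs_mult _ (_ * harm _ _)).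
  pose proof (Rabs_sign_pow s 1 Hs) as E. rewrite pow_1 in E.
  rewrite Rabs_mult, E, (Rabs_pos_eq 2) by lra.
  pose proof (Rabs_sign_harm n). lra.
Qed.

Lemma tame_sign : tame (fun n => s ^ n).
Proof. exact (tame_of_summable _ 2 (summable_sign 1 (Nat.le_refl 1))). Qed.

Lemma tame_sign_harm : tame (fun n => s ^ n * harm 1 n).
Proof. exact (tame_of_summable _ 3 (summable_sign_harm 2 (Nat.le_refl 2))). Qed.

Lemma exp_series_sign (u : R) :
  0 < u -> exp_series (fun n => s ^ n) u = exp (- u) / (1 - s * exp (- u)).
Proof.
  intros Hu. unfold exp_series.
  transitivity (Series (fun n => exp (- u) * (s * exp (- u)) ^ n)).
  - apply Series_ext. intros n. rewrite exp_neg_pow, Rpow_mult_distr. simpl. ring.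
  - rewrite Series_scal_l, Series_geom; [reflexivity|].
    pose proof (Rabs_sign_pow s 1 Hs) as E. rewrite pow_1 in E.
    rewrite Rabs_mult, E, Rmult_1_l, Rabs_pos_eq by (left; apply exp_pos).
    now apply exp_neg_lt_1.
Qed.

Lemma is_derive_sign_log (u : R) :
  0 < u -> is_derive (sign_log s) u (- (exp (- u) / (1 - s * exp (- u)))).
Proof.
  intros Hu. pose proof (sign_exp_lt_1 s u Hs Hu). unfold sign_log.
  auto_derive; [lra|].
  replace (- (exp (- u) / (1 - s * exp (- u))))
    with (- (s * s) * exp (- u) / (1 - s * exp (- u))) by (rewrite Hs; field; lra).
  field. lra.
Qed.

Lemma sign_log_p_infty :
  filterlim (sign_log s) (Rbar_locally p_infty) (locally 0).
Proof.
  unfold sign_log.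
  replace 0 with (- s * ln (1 - s * 0)) by (rewrite Rmult_0_r, Rminus_0_r, ln_1; ring).
  apply filterlim_Rmult; [typeclasses eauto | apply filterlim_const |].
  apply (filterlim_comp _ _ _ (fun u => 1 - s * exp (- u)) ln _ (locally (1 - s * 0))).
  - apply filterlim_Rminus; [typeclasses eauto | apply filterlim_const |].
    apply filterlim_Rmult; [typeclasses eauto | apply filterlim_const |].
    exact (upper_gamma_p_infty 0).
  - apply (continuous_ln (1 - s * 0)). lra.
Qed.

Lemma exp_series_sign_log (u : R) :
  0 < u -> exp_series (over_index (fun n => s ^ n)) u = sign_log s u.
Proof.
  apply (eq_of_derive_limit _ _ (fun u => - (exp (- u) / (1 - s * exp (- u)))) 0).
  - intros v Hv. rewrite <- exp_series_sign by exact Hv.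
    apply is_derive_exp_series; [exact tame_sign | exact Hv].
  - exact is_derive_sign_log.
  - apply exp_series_p_infty, tame_over_index, tame_sign.
  - exact sign_log_p_infty.
Qed.

(** Shifting the index and using [H_(n+1) = H_n + 1 / (n + 1)] shows that the sum [T] satisfies
    [T = s exp (- u) (T + sign_log s u)], which is solved for [T]; no Cauchy product is needed. *)
Lemma exp_series_sign_harm (u : R) :
  0 < u ->
  exp_series (fun n => s ^ n * harm 1 n) u
  = s * exp (- u) / (1 - s * exp (- u)) * sign_log s u.
Proof.
  intros Hu. pose proof (sign_exp_lt_1 s u Hs Hu) as Hp.
  set (T := exp_series (fun n => s ^ n * harm 1 n) u).
  assert (E : T = s * exp (- u) * (T + sign_log s u)).
  { unfold T at 1, exp_series.
    rewrite Series_incr_1 by (apply tame_ex_series; [exact tame_sign_harm | exact Hu]).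
    rewrite <- exp_series_sign_log by exact Hu. unfold T, exp_series.
    rewrite <- Series_plus, <- Series_scal_l;
      [| apply tame_ex_series; [exact tame_sign_harm | exact Hu]
       | apply tame_ex_series; [apply tame_over_index, tame_sign | exact Hu]].
    simpl (harm 1 0). rewrite Rmult_0_r, Rmult_0_l, Rplus_0_l.
    apply Series_ext. intros n. rewrite harm_S, pow1, !exp_neg_pow. unfold over_index.
    pose proof (INR_S_neq_0 n). simpl pow. field. assumption. }
  assert (E' : T * (1 - s * exp (- u)) = s * exp (- u) * sign_log s u) by lra.
  replace (s * exp (- u) / (1 - s * exp (- u)) * sign_log s u)
    with (s * exp (- u) * sign_log s u / (1 - s * exp (- u))) by (unfold Rdiv; ring).
  rewrite <- E'. field. lra.
Qed.

Lemma exp_series_scal (k : R) (c : nat -> R) (v : R) :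
  exp_series (fun n => k * c n) v = k * exp_series c v.
Proof.
  unfold exp_series. rewrite <- Series_scal_l. apply Series_ext. intros n. ring.
Qed.

(** The derivative of the square is a multiple of the harmonic series just summed; integrating
    termwise divides its coefficients by the index. *)
Lemma exp_series_sign_log_sq (u : R) :
  0 < u ->
  exp_series (over_index (fun n => 2 * s * (s ^ n * harm 1 n))) u = sign_log s u ^ 2.
Proof.
  assert (Ht : tame (fun n => 2 * s * (s ^ n * harm 1 n))).
  { intros v Hv. apply ex_series_ext_R with
      (fun n => 2 * (Rabs (s ^ n * harm 1 n) * exp (- (INR (S n) * v)))).
    - intros n. pose proof (Rabs_sign_pow s 1 Hs) as E. rewrite pow_1 in E.
      rewrite (Rabs_mult (2 * s)), (Rabs_mult 2), E, (Rabs_pos_eq 2) by lra. ring.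
    - exact (ex_series_scal_l 2 _ (tame_sign_harm v Hv)). }
  apply (eq_of_derive_limit _ (fun u => sign_log s u ^ 2)
           (fun u => - (2 * sign_log s u * (exp (- u) / (1 - s * exp (- u))))) 0).
  - intros v Hv.
    replace (2 * sign_log s v * (exp (- v) / (1 - s * exp (- v))))
      with (exp_series (fun n => 2 * s * (s ^ n * harm 1 n)) v).
    + now apply is_derive_exp_series.
    + rewrite exp_series_scal, exp_series_sign_harm by exact Hv.
      pose proof (sign_exp_lt_1 s v Hs Hv).
      replace (2 * sign_log s v * (exp (- v) / (1 - s * exp (- v))))
        with (2 * (s * s) * sign_log s v * (exp (- v) / (1 - s * exp (- v)))) by (rewrite Hs; ring).
      field. lra.
  - intros v Hv. pose proof (is_derive_sign_log v Hv) as D.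
    pose proof (is_derive_mult (sign_log s) (sign_log s) v _ _ D D Rmult_comm) as DD.
    apply (is_derive_ext (fun t => sign_log s t * sign_log s t)); [intros t; simpl; ring|].
    evar_last; [exact DD|].
    change (- (exp (- v) / (1 - s * exp (- v))) * sign_log s v
            + sign_log s v * - (exp (- v) / (1 - s * exp (- v)))
            = - (2 * sign_log s v * (exp (- v) / (1 - s * exp (- v))))). ring.
  - apply exp_series_p_infty, tame_over_index, Ht.
  - apply filterlim_ext with (fun t => sign_log s t * sign_log s t); [intros t; simpl; ring|].
    replace 0 with (0 * 0) by ring.
    apply filterlim_Rmult; [typeclasses eauto | |]; exact sign_log_p_infty.
Qed.

Lemma sign_pow_pred (n : nat) : s ^ n = s * s ^ S n.
Proof. simpl pow. rewrite <- Rmult_assoc, Hs. ring. Qed.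

Lemma improper_sign (p : nat) :
  (1 <= p)%nat ->
  improper (fun u => u ^ p * (exp (- u) / (1 - s * exp (- u))))
    (INR (fact p) * (s * sign_zeta s (S p))).
Proof.
  intros Hp.
  apply improper_ext with (fun u => u ^ p * exp_series (fun n => s ^ n) u).
  { intros u Hu. now rewrite exp_series_sign. }
  replace (s * sign_zeta s (S p)) with (Series (fun n => s ^ n / INR (S n) ^ S p)).
  - apply improper_exp_series. now apply summable_sign.
  - unfold sign_zeta. rewrite <- Series_scal_l. apply Series_ext. intros n.
    rewrite (sign_pow_pred n). unfold Rdiv. ring.
Qed.

Lemma improper_sign_log (p : nat) :
  improper (fun u => u ^ p * sign_log s u) (INR (fact p) * (s * sign_zeta s (S (S p)))).
Proof.
  apply improper_ext with (fun u => u ^ p * exp_series (over_index (fun n => s ^ n)) u).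
  { intros u Hu. now rewrite exp_series_sign_log. }
  replace (s * sign_zeta s (S (S p)))
    with (Series (fun n => over_index (fun n => s ^ n) n / INR (S n) ^ S p)).
  - apply improper_exp_series, summable_sign_over_index.
  - unfold sign_zeta. rewrite <- Series_scal_l. apply Series_ext. intros n.
    unfold over_index. rewrite (sign_pow_pred n), <- (tech_pow_Rmult (INR (S n)) (S p)).
    pose proof (INR_S_neq_0 n) as Hn. field. split; [now apply pow_nonzero | exact Hn].
Qed.

(** The coefficients of the series carry [H_(N-1) = H_N - 1 / N], which accounts for the subtracted
    [sign_zeta]. *)
Lemma improper_sign_log_sq (p : nat) :
  (1 <= p)%nat ->
  improper (fun u => u ^ p * sign_log s u ^ 2)
    (INR (fact p) *
     (2 * (Series (fun n => s ^ S n * harm 1 (S n) / INR (S n) ^ S (S p))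
           - sign_zeta s (S (S (S p)))))).
Proof.
  intros Hp.
  apply improper_ext with
    (fun u => u ^ p * exp_series (over_index (fun n => 2 * s * (s ^ n * harm 1 n))) u).
  { intros u Hu. now rewrite exp_series_sign_log_sq. }
  match goal with |- improper _ (_ * ?x) => replace x with
    (Series (fun n => over_index (fun n => 2 * s * (s ^ n * harm 1 n)) n / INR (S n) ^ S p)) end.
  - now apply improper_exp_series, summable_sign_harm_over_index.
  - unfold sign_zeta. rewrite <- Series_minus, <- Series_scal_l.
    + apply Series_ext. intros n. unfold over_index. rewrite harm_S, pow1.
      rewrite <- !(tech_pow_Rmult (INR (S n))), <- !(tech_pow_Rmult s n).
      pose proof (INR_S_neq_0 n) as Hn. field. split; [now apply pow_nonzero | exact Hn].
    + apply ex_series_harm; [exact Hs | lia].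
    + apply ex_series_sign_zeta; [exact Hs | lia].
Qed.

Lemma improper_sign_mul_log (p : nat) :
  (2 <= p)%nat ->
  improper (fun u => u ^ p * (s * exp (- u) / (1 - s * exp (- u)) * sign_log s u))
    (INR (fact p) *
     (s * (Series (fun n => s ^ S n * harm 1 (S n) / INR (S n) ^ S p) - sign_zeta s (S (S p))))).
Proof.
  intros Hp.
  apply improper_ext with (fun u => u ^ p * exp_series (fun n => s ^ n * harm 1 n) u).
  { intros u Hu. now rewrite exp_series_sign_harm. }
  match goal with |- improper _ (_ * ?x) => replace x with
    (Series (fun n => s ^ n * harm 1 n / INR (S n) ^ S p)) end.
  - now apply improper_exp_series, summable_sign_harm.
  - unfold sign_zeta. rewrite <- Series_minus, <- Series_scal_l.
    + apply Series_ext. intros n. rewrite harm_S, pow1, (sign_pow_pred n).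
      rewrite <- !(tech_pow_Rmult (INR (S n))).
      pose proof (INR_S_neq_0 n) as Hn. field. split; [now apply pow_nonzero | exact Hn].
    + apply ex_series_harm; [exact Hs | lia].
    + apply ex_series_sign_zeta; [exact Hs | lia].
Qed.

End Signed_series.

(** * The function ln (1 + exp (- u)) and the involution *)

Definition softminus (u : R) : R := ln (1 + exp (- u)).

Lemma one_plus_exp_pos (u : R) : 0 < 1 + exp (- u).
Proof. pose proof (exp_pos (- u)). lra. Qed.

Lemma softminus_pos (u : R) : 0 < softminus u.
Proof.
  unfold softminus. rewrite <- ln_1. pose proof (exp_pos (- u)).
  apply ln_increasing; lra.
Qed.

Lemma softminus_0 : softminus 0 = ln 2.
Proof. unfold softminus. rewrite Ropp_0, exp_0. f_equal. Qed.

Lemma sign_log_opp_1 (u : R) : sign_log (-1) u = softminus u.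
Proof.
  unfold sign_log, softminus. replace (1 - -1 * exp (- u)) with (1 + exp (- u)) by ring. ring.
Qed.

Lemma exp_opp_softminus (u : R) : exp (- softminus u) = / (1 + exp (- u)).
Proof. unfold softminus. rewrite exp_Ropp, exp_ln; [reflexivity | apply one_plus_exp_pos]. Qed.

Lemma is_derive_softminus (u : R) :
  is_derive softminus u (- (exp (- u) / (1 + exp (- u)))).
Proof.
  pose proof (one_plus_exp_pos u). unfold softminus. auto_derive; [lra | field; lra].
Qed.

Lemma sign_log_softminus (u : R) : sign_log 1 (softminus u) = u + softminus u.
Proof.
  unfold sign_log. rewrite exp_opp_softminus. pose proof (one_plus_exp_pos u).
  replace (1 - 1 * / (1 + exp (- u))) with (exp (- u) / (1 + exp (- u))) by (field; lra).
  rewrite ln_div, ln_exp by (try apply exp_pos; lra). unfold softminus. ring.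
Qed.

Lemma sign_log_add_softminus (u : R) : sign_log 1 (u + softminus u) = softminus u.
Proof.
  unfold sign_log. rewrite Ropp_plus_distr, exp_plus, exp_opp_softminus.
  pose proof (one_plus_exp_pos u).
  replace (1 - 1 * (exp (- u) * / (1 + exp (- u)))) with (/ (1 + exp (- u))) by (field; lra).
  rewrite ln_Rinv by lra. unfold softminus. ring.
Qed.

(** The target is the one-sided filter because the primitives composed with [softminus] are only
    known to have a limit at [0+]. *)
Lemma softminus_p_infty :
  filterlim softminus (Rbar_locally p_infty) (at_right 0).
Proof.
  assert (H : filterlim softminus (Rbar_locally p_infty) (locally 0)).
  { apply filterlim_ext with (sign_log (-1)); [apply sign_log_opp_1|].
    apply sign_log_p_infty. }
  intros P [eps HP].
  pose proof (proj1 (filterlim_locally _ _) H eps) as HB.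
  unfold filtermap. revert HB. apply filter_imp. intros u Hu.
  apply HP; [exact Hu | apply softminus_pos].
Qed.

(* [v |-> - ln (1 - exp (- v))] is a decreasing involution of (0, +oo) fixing [ln 2];
   its two halves are parametrised by [v = softminus u] and [v = u + softminus u]. *)
Lemma improper_symmetric (P : R -> R -> R) (l : R) :
  (forall x y, P x y = P y x) ->
  improper (fun v => P v (sign_log 1 v)) l ->
  improper (fun u => P (softminus u) (u + softminus u)) l.
Proof.
  intros HP (G & a & b & HG & Ga & Gb & ->).
  assert (D1 : forall u, 0 <= u -> is_derive (fun u => G (u + softminus u)) u
            (1 / (1 + exp (- u)) * P (softminus u) (u + softminus u))).
  { intros u Hu. pose proof (softminus_pos u). pose proof (one_plus_exp_pos u).
    apply (is_derive_comp G (fun u => u + softminus u)).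
    (* Symmetry of [P] is used on this half, where [v = u + softminus u] must be its first
       argument. *)
    - rewrite HP. rewrite <- (sign_log_add_softminus u) at 3. apply HG. lra.
    - evar_last.
      + apply (is_derive_plus (fun u => u) softminus);
          [apply is_derive_id | apply is_derive_softminus].
      + change (1 + - (exp (- u) / (1 + exp (- u))) = 1 / (1 + exp (- u))). field. lra. }
  assert (D2 : forall u, is_derive (fun u => G (softminus u)) u
            (- (exp (- u) / (1 + exp (- u))) * P (softminus u) (u + softminus u))).
  { intros u. apply (is_derive_comp G softminus); [|apply is_derive_softminus].
    rewrite <- sign_log_softminus. apply HG, softminus_pos. }
  (* The weights [1 / (1 + exp (- u))] and [exp (- u) / (1 + exp (- u))] of the two halves add up to
     1. At [u = 0] both arguments of [G] are [ln 2]; as [u] grows one goes to infinity and the other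
     to [0+]. *)
  exists (fun u => G (u + softminus u) - G (softminus u)), 0, (b - a).
  refine (conj _ (conj _ (conj _ _))).
  - intros u Hu. evar_last; [apply (is_derive_minus (fun u => G (u + softminus u))
      (fun u => G (softminus u))); [apply D1; lra | apply D2] |].
    pose proof (one_plus_exp_pos u).
    change (1 / (1 + exp (- u)) * P (softminus u) (u + softminus u)
            - - (exp (- u) / (1 + exp (- u))) * P (softminus u) (u + softminus u)
            = P (softminus u) (u + softminus u)). field. lra.
  - assert (E : G (0 + softminus 0) - G (softminus 0) = 0) by (rewrite Rplus_0_l; ring).
    replace (locally 0) with (locally (G (0 + softminus 0) - G (softminus 0))) by now rewrite E.
    apply (filterlim_at_right_continuous (fun u => G (u + softminus u) - G (softminus u)) 0).
    apply (ex_derive_continuous (fun u => G (u + softminus u) - G (softminus u))).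
    eexists. apply (is_derive_minus (fun u => G (u + softminus u)) (fun u => G (softminus u)));
      [apply D1; lra | apply D2].
  - apply filterlim_Rminus; [typeclasses eauto | |].
    + apply (filterlim_comp _ _ _ (fun u => u + softminus u) G _ (Rbar_locally p_infty));
        [|exact Gb].
      intros Q [M HM]. exists M. intros u Hu. apply HM. pose proof (softminus_pos u). lra.
    + exact (filterlim_comp _ _ _ softminus G _ _ _ softminus_p_infty Ga).
  - ring.
Qed.

(** For [v = softminus u] one has [dv = - (1 - exp (- v)) du], so the integrand becomes
    [v^p / (1 - exp (- v))] on [(0, ln 2]]. Expanding [1 / (1 - exp (- v))] as 1 plus a geometric
    series gives the primitive [K]: its limit at [0+] produces the zeta value and its value at
    [ln 2] the remaining terms. *)
Lemma improper_softminus_pow (p : nat) :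
  (1 <= p)%nat ->
  improper (fun u => softminus u ^ p)
    (INR (fact p) * zeta_nat (S p) + ln 2 ^ S p / INR (S p)
     - exp_series_prim p (fun n => 1 ^ n) (ln 2)).
Proof.
  intros Hp.
  pose proof (summable_sign 1 ltac:(ring) p Hp) as Hc.
  set (c := fun n : nat => 1 ^ n) in *.
  set (K := fun v => v ^ S p / INR (S p) - exp_series_prim p c v).
  assert (Hl2 : 0 < ln 2) by (rewrite <- softminus_0; apply softminus_pos).
  assert (HK : forall v, 0 < v -> is_derive K v (v ^ p / (1 - exp (- v)))).
  { intros v Hv. pose proof (exp_neg_lt_1 v Hv). unfold K.
    evar_last.
    - apply (is_derive_minus (fun v => v ^ S p / INR (S p)) (exp_series_prim p c)).
      + auto_derive; [trivial|]. reflexivity.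
      + apply is_derive_exp_series_prim; [exact (tame_sign 1 ltac:(ring)) | exact Hv].
    - unfold c. rewrite (exp_series_sign 1 ltac:(ring) v Hv).
      change (1 * (INR (S p) * v ^ p) * / INR (S p) - - (v ^ p * (exp (- v) / (1 - 1 * exp (- v))))
              = v ^ p / (1 - exp (- v))).
      pose proof (INR_S_neq_0 p). field. lra. }
  assert (K0 : filterlim K (at_right 0) (locally (- (INR (fact p) * zeta_nat (S p))))).
  { replace (- (INR (fact p) * zeta_nat (S p)))
      with (0 - INR (fact p) * Series (fun n => c n / INR (S n) ^ S p)).
    - apply filterlim_Rminus; [typeclasses eauto | | now apply exp_series_prim_at_0].
      replace (locally 0) with (locally (0 ^ S p / INR (S p))).
      + apply (filterlim_at_right_continuous (fun v => v ^ S p / INR (S p))).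
        apply (ex_derive_continuous (fun v => v ^ S p / INR (S p))). auto_derive. trivial.
      + rewrite pow_i by lia. unfold Rdiv. now rewrite Rmult_0_l.
    - unfold zeta_nat.
      rewrite (Series_ext (fun n => c n / INR (S n) ^ S p) (fun n => / INR (S n) ^ S p)); [ring|].
      intros n. unfold c. rewrite pow1. unfold Rdiv. ring. }
  assert (HD : forall u, is_derive (fun u => K (softminus u)) u (- softminus u ^ p)).
  { intros u. evar_last.
    - apply (is_derive_comp K softminus); [apply HK, softminus_pos | apply is_derive_softminus].
    - rewrite exp_opp_softminus. pose proof (one_plus_exp_pos u). pose proof (exp_pos (- u)).
      change (- (exp (- u) / (1 + exp (- u))) * (softminus u ^ p / (1 - / (1 + exp (- u))))
              = - softminus u ^ p). field. lra. }
  exists (fun u => (-1) * K (softminus u)), ((-1) * K (ln 2)),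
    ((-1) * - (INR (fact p) * zeta_nat (S p))).
  refine (conj _ (conj _ (conj _ _))).
  - intros u _. replace (softminus u ^ p) with ((-1) * - softminus u ^ p) by ring.
    apply (is_derive_scal (fun u => K (softminus u))), HD.
  - apply filterlim_Rmult; [typeclasses eauto | apply filterlim_const |].
    rewrite <- softminus_0.
    apply (filterlim_at_right_continuous (fun u => K (softminus u))).
    apply (ex_derive_continuous (fun u => K (softminus u))). eexists. apply HD.
  - apply filterlim_Rmult; [typeclasses eauto | apply filterlim_const |].
    exact (filterlim_comp _ _ _ softminus K _ _ _ softminus_p_infty K0).
  - unfold K. ring.
Qed.

(** * Polylogarithms at 1/2 *)

Lemma exp_series_prim_ext (p : nat) (c d : nat -> R) (v : R) :
  (forall n, c n = d n) -> exp_series_prim p c v = exp_series_prim p d v.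
Proof.
  revert c d. induction p as [|p IH]; intros c d H; cbn [exp_series_prim];
    assert (H' : forall n, over_index c n = over_index d n)
      by (intros n; unfold over_index; now rewrite H);
    rewrite (exp_series_ext _ _ v H'); [reflexivity|].
  now rewrite (IH _ _ H').
Qed.

Lemma over_index_inv_pow (j n : nat) :
  over_index (fun n => / INR (S n) ^ j) n = / INR (S n) ^ S j.
Proof.
  unfold over_index. rewrite <- tech_pow_Rmult. pose proof (INR_S_neq_0 n) as H.
  field. split; [now apply pow_nonzero | exact H].
Qed.

Lemma exp_series_inv_pow (j : nat) :
  exp_series (fun n => / INR (S n) ^ j) (ln 2) = Li j (1 / 2).
Proof.
  apply Series_ext. intros n. rewrite exp_neg_pow, exp_Ropp, exp_ln by lra.
  replace (1 / 2) with (/ 2) by field. unfold Rdiv. ring.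
Qed.

Lemma exp_series_prim_inv_pow_0 (j : nat) :
  exp_series_prim 0 (fun n => / INR (S n) ^ j) (ln 2) = Li (S j) (1 / 2).
Proof.
  cbn [exp_series_prim]. rewrite (exp_series_ext _ _ _ (over_index_inv_pow j)).
  apply exp_series_inv_pow.
Qed.

(** Each integration by parts lowers the power of [ln 2] and raises the order of the polylogarithm,
    because [exp (- N ln 2) = 2^(-N)]. Rewriting with it repeatedly unrolls the primitive at [ln 2]
    into terms [ln 2 ^ i * Li k (1 / 2)]. *)
Lemma exp_series_prim_inv_pow_S (p j : nat) :
  exp_series_prim (S p) (fun n => / INR (S n) ^ j) (ln 2)
  = ln 2 ^ S p * Li (S j) (1 / 2)
    + INR (S p) * exp_series_prim p (fun n => / INR (S n) ^ S j) (ln 2).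
Proof.
  cbn [exp_series_prim]. rewrite (exp_series_ext _ _ _ (over_index_inv_pow j)).
  rewrite (exp_series_prim_ext p _ _ _ (over_index_inv_pow j)).
  now rewrite exp_series_inv_pow.
Qed.

Lemma Li_1_half : Li 1 (1 / 2) = ln 2.
Proof.
  assert (Hl2 : 0 < ln 2) by (rewrite <- softminus_0; apply softminus_pos).
  rewrite <- exp_series_inv_pow.
  rewrite (exp_series_ext _ (over_index (fun n => 1 ^ n))).
  - rewrite exp_series_sign_log by (try ring; exact Hl2). unfold sign_log.
    rewrite exp_Ropp, exp_ln by lra. replace (1 - 1 * / 2) with (/ 2) by field.
    rewrite ln_Rinv by lra. ring.
  - intros n. unfold over_index. rewrite pow1, pow_1. unfold Rdiv. ring.
Qed.

(** The constant coefficients are written as inverse zeroth powers so that the unrolling rules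
    apply. *)
Lemma improper_softminus_pow_Li (p : nat) :
  (1 <= p)%nat ->
  improper (fun u => softminus u ^ p)
    (INR (fact p) * zeta_nat (S p) + ln 2 ^ S p / INR (S p)
     - exp_series_prim p (fun n => / INR (S n) ^ 0) (ln 2)).
Proof.
  intros Hp. rewrite (exp_series_prim_ext p _ (fun n => 1 ^ n)).
  - now apply improper_softminus_pow.
  - intros n. rewrite pow1, pow_O. field.
Qed.

(** * Evaluation of the integrals *)

Lemma improper_minus (f g : R -> R) (l m : R) :
  improper f l -> improper g m -> improper (fun u => f u - g u) (l - m).
Proof.
  intros Hf Hg. replace (l - m) with (l + (-1) * m) by ring.
  apply improper_ext with (fun u => f u + (-1) * g u); [intros; ring|].
  now apply improper_plus; [|apply improper_scal].
Qed.

Lemma improper_eq (f g : R -> R) (l m : R) :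
  (forall u, 0 < u -> f u = g u) -> l = m -> improper f l -> improper g m.
Proof. intros H <-. now apply improper_ext. Qed.

Lemma improper_pow_softminus (p : nat) :
  improper (fun u => u ^ p * softminus u)
    (INR (fact p) * ((1 - 2 / 2 ^ S (S p)) * zeta_nat (S (S p)))).
Proof.
  refine (improper_eq _ _ _ _ _ _ (improper_sign_log (-1) ltac:(ring) p)).
  - intros u _. now rewrite sign_log_opp_1.
  - rewrite sign_zeta_opp_1 by lia. ring.
Qed.

Lemma improper_softminus : improper softminus (PI ^ 2 / 12).
Proof.
  refine (improper_eq _ _ _ _ _ _ (improper_pow_softminus 0)).
  - intros u _. simpl. ring.
  - rewrite zeta_nat_2. simpl. field.
Qed.

(** For [P = x y] the left integral is [zeta(3)]; removing the integral of [u b], which is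
    [3/4 zeta(3)], leaves that of [b^2]. *)
Lemma improper_softminus_sq : improper (fun u => softminus u ^ 2) (zeta_nat 3 / 4).
Proof.
  pose proof (improper_sign_log 1 ltac:(ring) 1) as A.
  rewrite sign_zeta_1 in A.
  pose proof (improper_symmetric (fun v w => v ^ 1 * w) _ ltac:(intros; simpl; ring) A) as B.
  refine (improper_eq _ _ _ _ _ _ (improper_minus _ _ _ _ B (improper_pow_softminus 1))).
  - intros u _. simpl. ring.
  - simpl. field.
Qed.

(** The integral of [softminus] is [PI^2 / 12] by its series and
    [PI^2 / 6 - ln 2 ^ 2 / 2 - Li 2 (1 / 2)] by the substitution. *)
Lemma Li_2_half : Li 2 (1 / 2) = PI ^ 2 / 12 - ln 2 ^ 2 / 2.
Proof.
  assert (H := improper_softminus_pow_Li 1 (Nat.le_refl 1)).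
  rewrite exp_series_prim_inv_pow_S, exp_series_prim_inv_pow_0, Li_1_half, zeta_nat_2 in H.
  refine ((fun E => _) (improper_unique _ _ _ improper_softminus
            (improper_ext _ _ _ _ H))); [|intros; apply pow_1].
  simpl in E. simpl. lra.
Qed.

(** The same comparison for the square, whose independent value comes from the symmetric
    relation. *)
Lemma Li_3_half :
  Li 3 (1 / 2) = 7 / 8 * zeta_nat 3 - PI ^ 2 / 12 * ln 2 + ln 2 ^ 3 / 6.
Proof.
  assert (H := improper_softminus_pow_Li 2 ltac:(lia)).
  rewrite !exp_series_prim_inv_pow_S, exp_series_prim_inv_pow_0, Li_1_half, Li_2_half in H.
  pose proof (improper_unique _ _ _ improper_softminus_sq H) as E.
  simpl in E. simpl. lra.
Qed.

Lemma improper_softminus_cube :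
  improper (fun u => softminus u ^ 3)
    (1 / 4 * PI ^ 2 * ln 2 ^ 2 - 21 / 4 * ln 2 * zeta_nat 3 - 6 * Li 4 (1 / 2)
     + 1 / 15 * PI ^ 4 - 1 / 4 * ln 2 ^ 4).
Proof.
  refine (improper_eq _ _ _ _ (fun u _ => eq_refl) _ (improper_softminus_pow_Li 3 ltac:(lia))).
  rewrite !exp_series_prim_inv_pow_S, exp_series_prim_inv_pow_0,
    Li_1_half, Li_2_half, Li_3_half, zeta_nat_4.
  simpl. field.
Qed.

Lemma improper_softminus_fourth :
  improper (fun u => softminus u ^ 4)
    (2 / 3 * PI ^ 2 * ln 2 ^ 3 - 21 / 2 * ln 2 ^ 2 * zeta_nat 3
     - 24 * ln 2 * Li 4 (1 / 2) - 4 / 5 * ln 2 ^ 5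
     - 24 * Li 5 (1 / 2) + 24 * zeta_nat 5).
Proof.
  refine (improper_eq _ _ _ _ (fun u _ => eq_refl) _ (improper_softminus_pow_Li 4 ltac:(lia))).
  rewrite !exp_series_prim_inv_pow_S, exp_series_prim_inv_pow_0,
    Li_1_half, Li_2_half, Li_3_half.
  simpl. field.
Qed.

Lemma improper_mul_softminus_sq :
  improper (fun u => u * softminus u ^ 2)
    (4 * Li 4 (1 / 2) - 1 / 24 * PI ^ 4 - 1 / 6 * PI ^ 2 * ln 2 ^ 2
     + 1 / 6 * ln 2 ^ 4 + 7 / 2 * ln 2 * zeta_nat 3).
Proof.
  pose proof (improper_plus _ _ _ _ (improper_sign_log 1 ltac:(ring) 2)
                (improper_sign_log_sq 1 ltac:(ring) 1 (Nat.le_refl 1))) as A.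
  rewrite !sign_zeta_1 in A.
  rewrite (Series_ext _ (fun n => harm 1 (S n) / INR (S n) ^ 3)) in A
    by (intros n; rewrite pow1; unfold Rdiv; ring).
  rewrite Series_harm_cube, zeta_nat_2, zeta_nat_4 in A.
  (* In terms of [u] the integrand is [u^2 b + 3 u b^2 + 2 b^3]; the first and last terms are
     subtracted, and the rest is divided by 3. *)
  pose proof (improper_symmetric (fun v w => v ^ 2 * w + v ^ 1 * w ^ 2) _
                ltac:(intros; simpl; ring) A) as B.
  pose proof (improper_minus _ _ _ _ (improper_minus _ _ _ _ B (improper_pow_softminus 2))
                (improper_scal 2 _ _ improper_softminus_cube)) as C.
  refine (improper_eq _ _ _ _ _ _ (improper_scal (1 / 3) _ _ C)).
  - intros u _. simpl. field.
  - rewrite zeta_nat_4. simpl. field.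
Qed.

Lemma improper_sq_softminus_sq :
  improper (fun u => u ^ 2 * softminus u ^ 2)
    (- (29 / 8) * zeta_nat 5 + 1 / 3 * PI ^ 2 * zeta_nat 3).
Proof.
  refine (improper_eq _ _ _ _ _ _ (improper_sign_log_sq (-1) ltac:(ring) 2 ltac:(lia))).
  - intros u _. now rewrite sign_log_opp_1.
  - rewrite Series_harm_fourth by ring. rewrite !sign_zeta_opp_1 by lia.
    rewrite zeta_nat_2. simpl. field.
Qed.

Lemma improper_mul_softminus_cube :
  improper (fun u => u * softminus u ^ 3)
    (12 * Li 5 (1 / 2) + 12 * ln 2 * Li 4 (1 / 2) + 2 / 5 * ln 2 ^ 5
     + 21 / 4 * zeta_nat 3 * ln 2 ^ 2 - 99 / 16 * zeta_nat 5
     - 1 / 3 * PI ^ 2 * ln 2 ^ 3 - 1 / 2 * zeta_nat 3 * PI ^ 2).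
Proof.
  pose proof (improper_sign_log_sq 1 ltac:(ring) 2 ltac:(lia)) as A.
  rewrite Series_harm_fourth, !sign_zeta_1, zeta_nat_2 in A by ring.
  (* Here the integrand is [u^2 b^2 + 2 u b^3 + b^4], and only the middle term is unknown. *)
  pose proof (improper_symmetric (fun v w => v ^ 2 * w ^ 2) _ ltac:(intros; simpl; ring) A) as B.
  pose proof (improper_minus _ _ _ _ (improper_minus _ _ _ _ B improper_sq_softminus_sq)
                improper_softminus_fourth) as C.
  refine (improper_eq _ _ _ _ _ _ (improper_scal (1 / 2) _ _ C)).
  - intros u _. simpl. field.
  - simpl. field.
Qed.

Lemma improper_pow_logistic (p : nat) :
  (1 <= p)%nat ->
  improper (fun u => u ^ p * exp (- u) / (1 + exp (- u)))
    (INR (fact p) * ((1 - 2 / 2 ^ S p) * zeta_nat (S p))).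
Proof.
  intros Hp. refine (improper_eq _ _ _ _ _ _ (improper_sign (-1) ltac:(ring) p Hp)).
  - intros u _. pose proof (one_plus_exp_pos u). field. lra.
  - rewrite sign_zeta_opp_1 by lia. ring.
Qed.

Lemma improper_cube_logistic_softminus :
  improper (fun u => u ^ 3 * exp (- u) * ln (1 + exp (- u)) / (1 + exp (- u)))
    (- (87 / 16) * zeta_nat 5 + 1 / 2 * PI ^ 2 * zeta_nat 3).
Proof.
  refine (improper_eq _ _ _ _ _ _
    (* The scaling by -1 undoes the factor [s = -1] in the generating function of the harmonic
       series. *)
    (improper_scal (-1) _ _ (improper_sign_mul_log (-1) ltac:(ring) 3 ltac:(lia)))).
  - intros u _. rewrite sign_log_opp_1. fold (softminus u).
    pose proof (one_plus_exp_pos u). field. lra.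
  - rewrite Series_harm_fourth by ring. rewrite !sign_zeta_opp_1 by lia.
    rewrite zeta_nat_2. simpl. field.
Qed.

Lemma zeta_INR (k : nat) : zeta (INR k) = zeta_nat k.
Proof.
  apply Series_ext. intros n. rewrite Rpower_Ropp, Rpower_pow; [reflexivity | apply INR_S_pos].
Qed.

Theorem corollary5p2 :
  is_int_0_infty (fun u => 1 / 4 * ln (1 + exp (- u))) (PI ^ 2 / 48)
  /\
  is_int_0_infty (fun u => u * ln (1 + exp (- u))) (3 / 4 * zeta 3)
  /\
  is_int_0_infty (fun u => (ln (1 + exp (- u))) ^ 2) (zeta 3 / 4)
  /\
  is_int_0_infty (fun u => u ^ 3 * exp (- u) / (1 + exp (- u)))
    (7 * PI ^ 4 / 120)
  /\
  is_int_0_infty (fun u => (ln (1 + exp (- u))) ^ 3)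
    (1 / 4 * PI ^ 2 * (ln 2) ^ 2 - 21 / 4 * ln 2 * zeta 3 - 6 * Li 4 (1 / 2)
     + 1 / 15 * PI ^ 4 - 1 / 4 * (ln 2) ^ 4)
  /\
  is_int_0_infty (fun u => u * (ln (1 + exp (- u))) ^ 2)
    (4 * Li 4 (1 / 2) - 1 / 24 * PI ^ 4 - 1 / 6 * PI ^ 2 * (ln 2) ^ 2
     + 1 / 6 * (ln 2) ^ 4 + 7 / 2 * ln 2 * zeta 3)
  /\
  is_int_0_infty (fun u => u ^ 4 * exp (- u) / (1 + exp (- u)))
    (45 / 2 * zeta 5)
  /\
  is_int_0_infty (fun u => u * (ln (1 + exp (- u))) ^ 3)
    (12 * Li 5 (1 / 2) + 12 * ln 2 * Li 4 (1 / 2) + 2 / 5 * (ln 2) ^ 5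
     + 21 / 4 * zeta 3 * (ln 2) ^ 2 - 99 / 16 * zeta 5
     - 1 / 3 * PI ^ 2 * (ln 2) ^ 3 - 1 / 2 * zeta 3 * PI ^ 2)
  /\
  is_int_0_infty
    (fun u => u ^ 3 * exp (- u) * ln (1 + exp (- u)) / (1 + exp (- u)))
    (- (87 / 16) * zeta 5 + 1 / 2 * PI ^ 2 * zeta 3)
  /\
  is_int_0_infty (fun u => (ln (1 + exp (- u))) ^ 4)
    (2 / 3 * PI ^ 2 * (ln 2) ^ 3 - 21 / 2 * (ln 2) ^ 2 * zeta 3
     - 24 * ln 2 * Li 4 (1 / 2) - 4 / 5 * (ln 2) ^ 5
     - 24 * Li 5 (1 / 2) + 24 * zeta 5).
Proof.
  assert (Z3 : zeta 3 = zeta_nat 3) by (rewrite <- zeta_INR; f_equal; simpl; ring).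
  assert (Z5 : zeta 5 = zeta_nat 5) by (rewrite <- zeta_INR; f_equal; simpl; ring).
  rewrite Z3, Z5.
  (* All ten integrands are differentiable on the whole line, since [1 + exp (- u)] is positive for
     every real [u]; this settles continuity uniformly. *)
  repeat match goal with |- _ /\ _ => split end;
    (apply improper_is_int_0_infty;
     [ intros u; pose proof (one_plus_exp_pos u);
       match goal with |- continuous ?f u => apply (ex_derive_continuous f) end;
       auto_derive; repeat split; lra |]).
  - refine (improper_eq _ _ _ _ (fun u _ => eq_refl) _
      (improper_scal (1 / 4) _ _ improper_softminus)).
    field.
  - refine (improper_eq _ _ _ _ _ _ (improper_pow_softminus 1)).
    + intros u _. now rewrite pow_1.
    + simpl. field.
  - exact improper_softminus_sq.
  - refine (improper_eq _ _ _ _ (fun u _ => eq_refl) _ (improper_pow_logistic 3 ltac:(lia))).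
    rewrite zeta_nat_4. simpl. field.
  - exact improper_softminus_cube.
  - exact improper_mul_softminus_sq.
  - refine (improper_eq _ _ _ _ (fun u _ => eq_refl) _ (improper_pow_logistic 4 ltac:(lia))).
    simpl. field.
  - exact improper_mul_softminus_cube.
  - exact improper_cube_logistic_softminus.
  - exact improper_softminus_fourth.
Qed.
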